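(* With probability one there exists $n_0$ such that for every $n\ge n_0$ the function $\mathbb R^4\ni(\alpha',\mu'_\varepsilon,\theta_1',\theta_2')\mapsto Q_n(\mathbf Y_n;\alpha',\mu'_\varepsilon,\theta_1',\theta_2')$ has a unique global minimizer, denoted $(\hat\alpha_n,\hat\mu_{\varepsilon,n},\hat\theta_{1,n},\hat\theta_{2,n})$. Moreover, for every $(\alpha,\mu_\varepsilon,\theta_1,\theta_2)\in(0,1)\times(0,\infty)\times\mathbb N^2$, almost surely $\hat\alpha_n\to\alpha$, $\hat\mu_{\varepsilon,n}\to\mu_\varepsilon$ and $$\begin{bmatrix}\hat\theta_{1,n}\\ \hat\theta_{2,n}\end{bmatrix}\to\begin{bmatrix}Y_s\\ Y_{s+1}\end{bmatrix}+\frac{1}{1+\alpha^2+\alpha^4}\begin{bmatrix}-\alpha(1+\alpha^2)Y_{s-1}-\alpha^2Y_{s+2}-(1-\alpha^3)\mu_\varepsilon\\ -\alpha^2Y_{s-1}-\alpha(1+\alpha^2)Y_{s+2}-(1-\alpha^3)\mu_\varepsilon\end{bmatrix}.$$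
   Context: INAR(1) process: Let $\alpha\in(0,1)$. Let $(\varepsilon_k)_{k\in\mathbb N}$ be i.i.d. non-negative integer-valued random variables with $\mathbb E\varepsilon_1^2<\infty$ and $\mathbb P(\varepsilon_1\ne 0)>0$; write $\mu_\varepsilon=\mathbb E\varepsilon_1$. For each $k\in\mathbb N$ let $(\xi_{k,j})_{j\in\mathbb N}$ be i.i.d. Bernoulli random variables with mean $\alpha$, these sequences being mutually independent and independent of $(\varepsilon_k)$. Let $X_0$ be a non-negative integer-valued random variable with $\mathbb E X_0^2<\infty$, independent of all $\xi_{k,j}$ and $\varepsilon_k$, and set $X_k=\sum_{j=1}^{X_{k-1}}\xi_{k,j}+\varepsilon_k$ for $k\in\mathbb N$. Two neighbouring additive outliers: fix known $s\in\mathbb N$ and $\theta_1,\theta_2\in\mathbb N$; $Y_k=X_k+\delta_{k,s}\theta_1+\delta_{k,s+1}\theta_2$, $k\in\mathbb Z_+$; $\mathbf Y_n=(Y_0,\dots,Y_n)$. For $n\ge\max(3,s+2)$, $$Q_n(\mathbf y_n;\alpha',\mu'_\varepsilon,\theta_1',\theta_2')=\sum_{\substack{k=1\\k\notin\{s,s+1,s+2\}}}^n(y_k-\alpha'y_{k-1}-\mu'_\varepsilon)^2+(y_s-\alpha'y_{s-1}-\mu'_\varepsilon-\theta_1')^2+(y_{s+1}-\alpha'y_s-\mu'_\varepsilon+\alpha'\theta_1'-\theta_2')^2+(y_{s+2}-\alpha'y_{s+1}-\mu'_\varepsilon+\alpha'\theta_2')^2 .$$ *)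

(* Defs.v *)
From HB Require Import structures.
From mathcomp Require Import all_boot all_order all_algebra.
From mathcomp Require Import all_classical all_reals all_analysis.
Set Implicit Arguments. Unset Strict Implicit. Unset Printing Implicit Defensive.
Import Order.TTheory GRing.Theory Num.Theory.
Import numFieldNormedType.Exports.
Local Open Scope classical_set_scope.
Local Open Scope ring_scope.

(* None = X_0, Some (inl k) = eps_k, Some (inr (k, j)) = xi_{k,j}. *)
Definition inar_idx : eqType := option (nat + (nat * nat))%type.

(* Only eps_k (k >= 1) and xi_{k,j} (k, j >= 1) are part of the model. *)
Definition inar_valid (i : inar_idx) : bool :=
  match i with None => true | Some (inl k) => (0 < k)%N
  | Some (inr (k, j)) => (0 < k)%N && (0 < j)%N end.

Definition inar_rv (T : Type) (X0 : T -> nat) (eps : nat -> T -> nat)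
  (xi : nat -> nat -> T -> nat) (i : inar_idx) : T -> nat :=
  match i with None => X0 | Some (inl k) => eps k | Some (inr (k, j)) => xi k j end.

Definition mutually_independent {d} {T : measurableType d} {R : realType}
  (P : probability T R) (I : eqType) (valid : I -> bool) (Z : I -> T -> nat) :=
  forall (F : seq I) (B : I -> set nat),
    uniq F -> all valid F ->
    P (\bigcap_(i in [set i | i \in F]) (Z i @^-1` B i)) =
    (\prod_(i <- F) P (Z i @^-1` B i))%E.

Fixpoint inarX (T : Type) (X0 : T -> nat) (eps : nat -> T -> nat)
  (xi : nat -> nat -> T -> nat) (k : nat) (w : T) : nat :=
  match k with
  | 0 => X0 w
  | k'.+1 => (\sum_(1 <= j < (inarX X0 eps xi k' w).+1) xi k'.+1 j w + eps k'.+1 w)%N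
  end.

(* Observed process with two neighbouring additive outliers at s and s+1. *)
Definition inarY {R : realType} (T : Type) (X0 : T -> nat) (eps : nat -> T -> nat)
  (xi : nat -> nat -> T -> nat) (s th1 th2 : nat) (k : nat) (w : T) : R :=
  (inarX X0 eps xi k w)%:R + (if k == s then th1%:R else 0)
  + (if k == s.+1 then th2%:R else 0).

Definition Qn {R : realType} (s n : nat) (y : nat -> R) (a mu t1 t2 : R) : R :=
  \sum_(1 <= k < n.+1 | k \notin [:: s; s.+1; s.+2]) (y k - a * y k.-1 - mu) ^+ 2
  + (y s - a * y s.-1 - mu - t1) ^+ 2
  + (y s.+1 - a * y s - mu + a * t1 - t2) ^+ 2
  + (y s.+2 - a * y s.+1 - mu + a * t2) ^+ 2.

Definition unique_global_minimizer {R : realType} (f : R -> R -> R -> R -> R)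
  (a m t1 t2 : R) : Prop :=
  (forall a' m' t1' t2', f a m t1 t2 <= f a' m' t1' t2') /\
  (forall a' m' t1' t2', (forall a'' m'' t1'' t2'', f a' m' t1' t2' <= f a'' m'' t1'' t2'') ->
     (a', m', t1', t2') = (a, m, t1, t2)).

(* Main.v *)
Require Import Defs.
From HB Require Import structures.
From mathcomp Require Import all_boot all_order all_algebra.
From mathcomp Require Import all_classical all_reals all_analysis.
From mathcomp Require Import measurable_realfun.
From mathcomp Require Import ring lra zify.
Set Implicit Arguments.
Unset Strict Implicit.
Unset Printing Implicit Defensive.
Import Order.TTheory GRing.Theory Num.Theory.
Import numFieldNormedType.Exports.
Local Open Scope classical_set_scope.
Local Open Scope ring_scope.

(** No stationary law or ergodic theorem is invoked: the laws of large numbers are proved from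
    uniformly bounded second moments of the chain, started from any square-integrable [X0].
    Conditional expectations are avoided as well. The history of the chain takes countably many
    values, so conditioning on it means integrating over its atoms, and the Markov property becomes
    a product formula on each atom. The truncation base 3 has to lie strictly between 2 and 4. The
    residual at state x has conditional variance linear in x, so level t^m gives truncated terms of
    second moment O(t^m). The maximal inequality over 4^m terms then needs t < 4, and the union
    bound for the truncation event, of order (4/t^2)^m, needs t > 2. The reduced criterion need not
    be convex, because the outlier term is not. Its second differences are however bounded below on
    a fixed region by a constant independent of n, so the growing least-squares curvature eventually
    wins. *)

(** Minimising first over the two outlier parameters replaces the three
exceptional squares by N^2 / D, where D = 1 + a^2 + a^4 and
N = y_{s+2} - a^3 y_{s-1} - (1 + a + a^2) m: the residual vector is projected on
(a^2, a, 1).  What remains is an ordinary least-squares function of (a, m), whose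
curvature grows linearly in n, plus this fixed nonnegative function, which is
smooth; so for large n the minimiser exists, lies close to the true parameter,
and is unique.

This needs only three facts about X, with M_k = X_k - alpha X_{k-1} - mu:
the sums of M_k and of M_k X_{k-1} are o(n) almost surely, and X_k <> X_{k-1}
has positive lower frequency, which with the boundedness of the empirical mean
bounds the design matrix below.  All three are strong laws for martingale
differences.  As X has only two moments, M_k X_{k-1} need not be square
integrable: for k < 4^m it is truncated at X_{k-1} <= 3^m, at the price of an
event of probability O((4/9)^m). *)

(** * Countable partitions and square-integrable variables *)

Section atoms.
Context {d : measure_display} {T : measurableType d} {R : realType}.
Variable P : probability T R.
Context {I : countType}.
Variable c : T -> I.
Hypothesis mc : forall v, measurable (c @^-1` [set v]).

(** A set that cannot separate points with the same code is the union of the atoms over its image, a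
    countable union because [I] is countable. Measurability of everything built from the chain is
    obtained in this way. *)
Lemma measurable_saturated (A : set T) :
  (forall w w', c w = c w' -> A w -> A w') -> measurable A.
Proof.
move=> Asat.
have -> : A = \bigcup_(v in c @` A) c @^-1` [set v].
  apply/seteqP; split => [w Aw|w [v [w' Aw' <-] /= cw]].
    by exists (c w) => //; exists w.
  by apply: Asat Aw'.
rewrite bigcup_mkcond; apply: countable_bigcupT_measurable => // v.
by case: ifP => // _; exact: mc.
Qed.

Lemma measurable_fun_saturated d' (T' : measurableType d') (f : T -> T') :
  (forall w w', c w = c w' -> f w = f w') -> measurable_fun setT f.
Proof.
move=> fsat _ B _; rewrite setTI; apply: measurable_saturated => w w' /fsat ff.
by rewrite /preimage /= ff.
Qed.

(** The atoms renumbered by natural numbers, so that countable additivity along sequences applies; a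
    number that codes no value of [c] gives the empty set. *)
Let F (i : nat) := [set w | pickle (c w) = i].

Let mF i : measurable (F i).
Proof. by apply: measurable_saturated => w w' cw; rewrite /F /= cw. Qed.

Let tF : trivIset setT F.
Proof. by move=> i j _ _ [w [/= <- <-]]. Qed.

Let UF : \bigcup_i F i = setT.
Proof. by apply/seteqP; split => // w _; exists (pickle (c w)). Qed.

Let F_atom i : F i = set0 \/ exists v, F i = c @^-1` [set v].
Proof.
have [->|/set0P[w Fw]] := eqVneq (F i) set0; first by left.
right; exists (c w); apply/seteqP; split => w' /=; rewrite /F /=.
  by rewrite -Fw => /(pcan_inj pickleK).
by move=> ->.
Qed.

(** This stands in for the tower property: equal conditional means give equal means. *)
Lemma eq_ge0_integral_atoms (f g : T -> R) :
  measurable_fun setT f -> measurable_fun setT g ->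
  (forall w, 0 <= f w) -> (forall w, 0 <= g w) ->
  (forall v, \int[P]_(w in c @^-1` [set v]) (f w)%:E =
             \int[P]_(w in c @^-1` [set v]) (g w)%:E)%E ->
  (\int[P]_w (f w)%:E = \int[P]_w (g w)%:E)%E.
Proof.
move=> mf mg f0 g0 fg; rewrite -UF !ge0_integral_bigcup//; last 4 first.
- by rewrite UF; exact/measurable_EFinP.
- by move=> w _; rewrite lee_fin.
- by rewrite UF; exact/measurable_EFinP.
- by move=> w _; rewrite lee_fin.
apply: eq_eseriesr => i _.
by have [->|[v ->]] := F_atom i; rewrite ?integral_set0.
Qed.

(** [W] is constant on each atom and can be pulled out there, leaving the vanishing integral of [V].
    This is E[W E[V | c]] = 0 without conditional expectation. *)
Lemma Rintegral_orthogonal (W V : T -> R) :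
  (forall w w', c w = c w' -> W w = W w') ->
  P.-integrable setT (EFin \o V) ->
  (forall v, \int[P]_(w in c @^-1` [set v]) V w = 0) ->
  P.-integrable setT (EFin \o (fun w => W w * V w)) ->
  \int[P]_w (W w * V w) = 0.
Proof.
move=> Wsat iV V0 iWV; rewrite /Rintegral -[X in integral _ X]UF.
rewrite integral_bigcup ?UF//= eseries0//= => i _ _.
have [->|[v ->]] := F_atom i; first by rewrite integral_set0.
have iVv : P.-integrable (c @^-1` [set v]) (EFin \o V).
  by apply: integrableS iV.
have [->|/set0P[w0 cw0]] := eqVneq (c @^-1` [set v]) set0.
  by rewrite integral_set0.
rewrite (eq_integral (fun w => (W w0)%:E * (V w)%:E)%E); last first.
  by move=> w; rewrite inE /= => cw; rewrite EFinM (Wsat w w0)// cw.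
rewrite integralZl// -[integral _ _ _]fineK ?integrable_fin_num//.
by rewrite [fine _]V0 mule0.
Qed.

End atoms.

(** * Square-integrable variables, orthogonality and Chebyshev's inequality *)

Section square_integrable.
Context {d : measure_display} {T : measurableType d} {R : realType}.
Variable P : probability T R.

Definition square_integrable (f : T -> R) :=
  measurable_fun setT f /\
  P.-integrable setT (EFin \o (fun w => f w ^+ 2)).

Let integrD (f g : T -> R) :
  P.-integrable setT (EFin \o f) -> P.-integrable setT (EFin \o g) ->
  P.-integrable setT (EFin \o (fun w => f w + g w)).
Proof.
by move=> if_ ig; apply: eq_integrable (integrableD measurableT if_ ig).
Qed.

Let integrZ (k : R) (f : T -> R) :
  P.-integrable setT (EFin \o f) ->
  P.-integrable setT (EFin \o (fun w => k * f w)).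
Proof.
by move=> if_; apply: eq_integrable (integrableZl measurableT k if_).
Qed.

Lemma square_integrable_le (f g : T -> R) : measurable_fun setT f ->
  (forall w, f w ^+ 2 <= g w ^+ 2) ->
  square_integrable g -> square_integrable f.
Proof.
move=> mf fg [mg ig]; split => //.
apply: le_integrable ig => //.
  by apply/measurable_EFinP; exact: measurable_funX.
by move=> w _ /=; rewrite lee_fin !ger0_norm ?sqr_ge0.
Qed.

Lemma square_integrable_cst (k : R) : square_integrable (cst k).
Proof.
split; first exact: measurable_cst.
exact: (@finite_measure_integrable_cst _ _ _ P setT (k ^+ 2) measurableT).
Qed.

Lemma square_integrable_mul (f g : T -> R) :
  square_integrable f -> square_integrable g ->
  P.-integrable setT (EFin \o (fun w => f w * g w)).
Proof.
move=> [mf if_] [mg ig].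
apply: (le_integrable measurableT _ _ (integrD if_ ig)).
  by apply/measurable_EFinP; exact: measurable_funM.
move=> w _ /=; rewrite lee_fin [leRHS]ger0_norm ?addr_ge0 ?sqr_ge0//.
by rewrite ler_norml; apply/andP; split; nra.
Qed.

Lemma square_integrable_integrable (f : T -> R) :
  square_integrable f -> P.-integrable setT (EFin \o f).
Proof.
move=> sf; have := square_integrable_mul sf (square_integrable_cst 1).
by apply: eq_integrable => // w _ /=; rewrite mulr1.
Qed.

Lemma square_integrableD (f g : T -> R) :
  square_integrable f -> square_integrable g ->
  square_integrable (fun w => f w + g w).
Proof.
move=> sf sg; split; first by case: sf sg => mf _ [mg _]; exact: measurable_funD.
have := integrD (integrD sf.2 sg.2)
  (integrZ 2 (square_integrable_mul sf sg)).
by apply: eq_integrable => // w _ /=; congr EFin; ring.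
Qed.

Lemma square_integrableZ (k : R) (f : T -> R) :
  square_integrable f -> square_integrable (fun w => k * f w).
Proof.
move=> [mf if_]; split; first exact: measurable_funM.
have := integrZ (k ^+ 2) if_.
by apply: eq_integrable => // w _ /=; rewrite exprMn.
Qed.

Lemma square_integrableB (f g : T -> R) :
  square_integrable f -> square_integrable g ->
  square_integrable (fun w => f w - g w).
Proof.
move=> sf sg.
rewrite (_ : (fun w => _) = (fun w => f w + -1 * g w)).
  by apply: square_integrableD => //; exact: square_integrableZ.
by apply/funext => w; rewrite mulN1r.
Qed.

Lemma Rintegral_sqrD (f g : T -> R) :
  square_integrable f -> square_integrable g -> \int[P]_w (f w * g w) = 0 ->
  \int[P]_w ((f w + g w) ^+ 2) = \int[P]_w (f w ^+ 2) + \int[P]_w (g w ^+ 2).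
Proof.
move=> sf sg fg0.
have ifg := square_integrable_mul sf sg.
have -> : (fun w => (f w + g w) ^+ 2) =
    (fun w => (f w ^+ 2 + g w ^+ 2) + 2 * (f w * g w)).
  by apply/funext => w; ring.
rewrite RintegralD// ?RintegralZl//.
- by rewrite fg0 mulr0 addr0 RintegralD//; [exact: sf.2|exact: sg.2].
- exact: (integrD sf.2 sg.2).
- exact: integrZ ifg.
Qed.

Lemma chebyshev_sqr (f : T -> R) (l : R) : 0 < l -> square_integrable f ->
  (P [set w | (l <= `|f w|)%R] <= (\int[P]_w (f w ^+ 2) / l ^+ 2)%:E)%E.
Proof.
move=> l0 [mf if_].
have mA : measurable [set w | l <= `|f w|].
  rewrite -[X in measurable X]setTI.
  have : measurable_fun setT (fun w => `|f w|).
    exact: measurableT_comp (@normr_measurable R setT) mf.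
  by move=> /(_ measurableT `[l, +oo[%classic) /=; rewrite preimage_itvcy; apply.
rewrite -[leLHS]fineK ?fin_num_measure// lee_fin ler_pdivlMr ?exprn_gt0//.
rewrite mulrC -Rintegral_cst//.
apply: (@le_trans _ _ (\int[P]_(w in [set w | l <= `|f w|]) (f w ^+ 2))).
  apply: le_Rintegral => //.
  - exact: finite_measure_integrable_cst.
  - exact: integrableS if_.
  - move=> w /= lf.
    by rewrite -(real_normK (num_real (f w))) lerXn2r// nnegrE// ltW.
rewrite /Rintegral fine_le//.
- by rewrite integrable_fin_num//; exact: integrableS if_.
- exact: integrable_fin_num.
- apply: ge0_subset_integral => //.
    by apply/measurable_EFinP; exact: measurable_funX.
  by move=> w _; rewrite lee_fin sqr_ge0.
Qed.

End square_integrable.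

(** * A strong law for martingale differences *)

Section martingale.
Context {d : measure_display} {T : measurableType d} {R : realType}.
Variable P : probability T R.
Context {I : countType}.
Variable c : nat -> T -> I.
Hypothesis mc : forall n v, measurable (c n @^-1` [set v]).
Hypothesis c_le : forall n w w', c n.+1 w = c n.+1 w' -> c n w = c n w'.

(** The atoms of [c n] describe the information at time n, and [V n] is the increment from n to n +
    1, hence known at time n + 1. The last clause expresses that its conditional mean given time n
    is zero. *)
Definition martingale_difference (V : nat -> T -> R) :=
  [/\ forall n w w', c n.+1 w = c n.+1 w' -> V n w = V n w',
      forall n, square_integrable P (V n) &
      forall n v, \int[P]_(w in c n @^-1` [set v]) V n w = 0].

Fixpoint stopped_sum (l : R) (V : nat -> T -> R) (n : nat) (w : T) : R :=
  if n is m.+1 then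
    let u := stopped_sum l V m w in if l <= `|u| then u else u + V m w
  else 0.

Lemma stopped_sum_saturated l V n w w' : martingale_difference V ->
  c n w = c n w' -> stopped_sum l V n w = stopped_sum l V n w'.
Proof.
move=> [Vs _ _]; elim: n => //= n IHn cn.
by rewrite (IHn (c_le cn)) (Vs _ _ _ cn).
Qed.

Lemma sum_saturated V n N w w' : martingale_difference V -> (n <= N)%N ->
  c N w = c N w' -> \sum_(i < n) V i w = \sum_(i < n) V i w'.
Proof.
move=> [Vs _ _] nN cN; apply: eq_bigr => i _; apply: Vs.
have: (i < N)%N by apply: leq_trans nN.
elim: N cN {nN} => // N IHN cN; rewrite ltnS leq_eqVlt => /predU1P[->//|].
by apply: IHN; exact: c_le.
Qed.

(* Stopping the partial sums when they first leave (-l, l) keeps the increments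
orthogonal to the past, so the second moments still add up. *)
Lemma stopped_sum_sqr l V B n : martingale_difference V ->
  (forall i, \int[P]_w (V i w ^+ 2) <= B) ->
  square_integrable P (stopped_sum l V n) /\
  \int[P]_w (stopped_sum l V n w ^+ 2) <= n%:R * B.
Proof.
move=> mdV VB; have [Vs V2 V0] := mdV.
elim: n => [|n [IH1 IH2]].
  split; first exact: square_integrable_cst.
  by rewrite /= expr0n /= mul0r Rintegral_cst// mul0r.
set U := stopped_sum l V n in IH1 IH2 *.
(* [b] indicates that no exit has happened yet. It depends on time n only, so [b w * V n w] is still
   orthogonal to the past. *)
pose b w : R := if l <= `|U w| then 0 else 1.
have Usat w w' : c n w = c n w' -> U w = U w'.
  by move=> cw; exact: stopped_sum_saturated.
have -> : stopped_sum l V n.+1 = (fun w => U w + b w * V n w).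
  by apply/funext => w; rewrite /= -/U /b; case: ifP; rewrite ?mul0r ?addr0 ?mul1r.
have mb : measurable_fun setT b.
  by apply: (measurable_fun_saturated (mc n)) => w w' cw; rewrite /b (Usat _ _ cw).
have b2 w : (b w * V n w) ^+ 2 <= V n w ^+ 2.
  by rewrite /b; case: ifP; rewrite ?mul0r ?mul1r// expr0n sqr_ge0.
have sb : square_integrable P (fun w => b w * V n w).
  apply: (square_integrable_le _ b2) (V2 n).
  by apply: measurable_funM => //; exact: (V2 n).1.
split; first exact: square_integrableD.
have orth : \int[P]_w (U w * (b w * V n w)) = 0.
  have iUV := square_integrable_mul IH1 sb.
  move: iUV; under [X in EFin \o X]eq_fun => w do rewrite mulrA; move=> iUV.
  under eq_Rintegral => w _ do rewrite mulrA.
  apply: (Rintegral_orthogonal (mc n)) => //.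
  - by move=> w w' cw; rewrite /b (Usat _ _ cw).
  - exact: square_integrable_integrable.
rewrite [leLHS](Rintegral_sqrD IH1 sb orth) [n.+1%:R]mulrS addrC mulrDl mul1r lerD//.
apply: le_trans (VB n); apply: le_Rintegral => //; first exact: sb.2.
exact: (V2 n).2.
Qed.

(** The stopped sum is frozen at the value with which it left (-l, l), so an exit at any earlier
    time is still visible at time N. *)
Lemma stopped_sum_exit l (V : nat -> T -> R) n N w : (n <= N)%N ->
  l <= `|\sum_(i < n) V i w| -> l <= `|stopped_sum l V N w|.
Proof.
move=> nN ln.
have stay m : l <= `|stopped_sum l V m w| -> l <= `|stopped_sum l V m.+1 w|.
  by move=> lm /=; rewrite lm.
have : l <= `|stopped_sum l V n w| \/
    stopped_sum l V n w = \sum_(i < n) V i w.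
  elim: n {nN ln} => [|n IHn]; first by right; rewrite big_ord0.
  have [ln|ln] := boolP (l <= `|stopped_sum l V n w|); first by left; exact: stay.
  by right; rewrite /= (negbTE ln) big_ord_recr /=; case: IHn => [/idPn//|->].
rewrite -(subnK nN); elim: (N - n)%N => [|k IHk]; first by case=> // ->.
by rewrite addSn => /IHk; exact: stay.
Qed.

(** Kolmogorov's inequality: an exit before N shows in the stopped sum at N, where Chebyshev's
    inequality applies. *)
Lemma maximal_inequality l V B N : 0 < l -> martingale_difference V ->
  (forall i, \int[P]_w (V i w ^+ 2) <= B) ->
  (P [set w | exists2 n, (n <= N)%N & (l <= `|\sum_(i < n) V i w|)%R] <=
    (N%:R * B / l ^+ 2)%:E)%E.
Proof.
move=> l0 mdV VB; have [sU UB] := stopped_sum_sqr l N mdV VB.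
apply: le_trans (le_trans _ (chebyshev_sqr l0 sU)) _; last first.
  by rewrite lee_fin ler_pM2r// invr_gt0 exprn_gt0.
apply: le_measure; rewrite ?inE.
- apply: (measurable_saturated (mc N)) => w w' cw [n nN ln].
  by exists n => //; rewrite -(sum_saturated mdV nN cw).
- apply: (measurable_saturated (mc N)) => w w' cw /=.
  by rewrite (stopped_sum_saturated l mdV cw).
- by move=> w [n nN]; exact: stopped_sum_exit.
Qed.

Lemma c_leq n N w w' : (n <= N)%N -> c N w = c N w' -> c n w = c n w'.
Proof.
move=> nN; rewrite -(subnK nN); elim: (N - n)%N => // k IHk.
by rewrite addSn => /c_le.
Qed.

(* [Vt m] is a truncation of [V] for the block n <= 4^m.  The thresholds
4^m (7/8)^m are o(4^m) and still make the exit probabilities summable, since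
(3/4) (8/7)^2 = 48/49. *)
Lemma strong_law (V : nat -> T -> R) (Vt : nat -> nat -> T -> R) (C : R) :
  (forall n w w', c n.+1 w = c n.+1 w' -> V n w = V n w') ->
  (forall m, martingale_difference (Vt m)) ->
  (forall m i, \int[P]_w (Vt m i w ^+ 2) <= C * 3 ^+ m) ->
  (forall m, P [set w | exists2 k, (k < 4 ^ m)%N & V k w != Vt m k w] <=
    (C * (4 / 9) ^+ m)%:E)%E ->
  {ae P, forall w, (\sum_(i < n) V i w) / n%:R @[n --> \oo] --> (0 : R)}.
Proof.
move=> Vs mdV VC badC.
pose bad m := [set w | exists2 k, (k < 4 ^ m)%N & V k w != Vt m k w].
pose l m : R := 4 ^+ m * (7 / 8) ^+ m.
have l_gt0 m : 0 < l m by rewrite mulr_gt0// exprn_gt0//; lra.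
pose E m := [set w | exists2 n, (n <= 4 ^ m)%N & l m <= `|\sum_(i < n) V i w|].
have mbad m : measurable (bad m).
  apply: (measurable_saturated (mc (4 ^ m))) => w w' cw [k km Vk].
  have ck := c_leq km cw; exists k => //.
  by rewrite -(Vs _ _ _ ck); case: (mdV m) => /(_ _ _ _ ck) <-.
have mE m : measurable (E m).
  apply: (measurable_saturated (mc (4 ^ m))) => w w' cw [n nm ln].
  exists n => //; rewrite (_ : \sum_(i < n) V i w' = \sum_(i < n) V i w)//.
  apply: eq_bigr => i _; apply: Vs; apply: c_leq (esym cw).
  exact: leq_trans (ltn_ord i) nm.
have C0 : 0 <= C.
  have := le_trans (measure_ge0 P _) (badC 0%N).
  by rewrite expr0 mulr1 lee_fin.
pose rho : R := 48 / 49.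
have PE m : (P (E m) <= (2 * C * rho ^+ m)%:E)%E.
  pose E' := [set w | exists2 n, (n <= 4 ^ m)%N &
    l m <= `|\sum_(i < n) Vt m i w|].
  have mE' : measurable E'.
    apply: (measurable_saturated (mc (4 ^ m))) => w w' cw [n nm ln].
    by exists n => //; rewrite -(sum_saturated (mdV m) nm cw).
  (* Off [bad m] the sums of [V] and of [Vt m] coincide throughout the block. *)
  apply: (@le_trans _ _ (P (bad m `|` E'))).
    apply: le_measure; rewrite ?inE//; first exact: measurableU.
    move=> w [n nm ln]; have [bw|nbw] := pselect (bad m w); [by left|right].
    exists n => //; rewrite (_ : \sum_(i < n) Vt m i w = \sum_(i < n) V i w)//.
    apply: eq_bigr => i _; apply/eqP; rewrite eq_sym; apply: contra_notT nbw.
    by move=> Vi; exists i => //; exact: leq_trans (ltn_ord i) nm.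
  apply: le_trans (measureU2 _ (mbad m) mE') _.
  apply: le_trans (leeD (badC m) (maximal_inequality _ (l_gt0 m) (mdV m) (VC m))) _.
  rewrite lee_fin /rho.
  have -> : (4 ^ m)%:R * (C * 3 ^+ m) / l m ^+ 2 = C * (48 / 49) ^+ m.
    have l0 := l_gt0 m.
    apply: (mulIf (lt0r_neq0 (exprn_gt0 2 l0))); rewrite mulfVK ?gt_eqF ?exprn_gt0//.
    rewrite /l natrX mulrCA -mulrA; congr (_ * _).
    by rewrite -exprMn -exprMn -exprM mulnC exprM -exprMn; congr (_ ^+ m); lra.
  rewrite [leRHS](_ : _ = C * (48 / 49) ^+ m + C * (48 / 49) ^+ m); last by ring.
  rewrite lerD2r ler_wpM2l//.
  by apply: lerXn2r; rewrite ?nnegrE; lra.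
(* Borel-Cantelli: almost surely only finitely many [E m] occur. *)
have : P (lim_sup_set E) = 0%E.
  apply: lim_sup_set_cvg0 => //.
  apply: (@le_lt_trans _ _ (\sum_(m <oo) (2 * C * rho ^+ m)%:E)%E).
    by apply: lee_nneseries => m *; [exact: measure_ge0|exact: PE].
  (* 49 = 1 / (1 - rho) is the sum of the geometric series. *)
  apply: (@le_lt_trans _ _ (2 * C * 49)%:E); last by rewrite ltry.
  apply: lime_le.
    apply: is_cvg_nneseries => m _ _.
    by rewrite lee_fin mulr_ge0 ?mulr_ge0// exprn_ge0// /rho; lra.
  apply: nearW => n; rewrite sumEFin lee_fin -mulr_sumr ler_wpM2l ?mulr_ge0//.
  suff -> : \sum_(0 <= i < n) rho ^+ i = 49 * (1 - rho ^+ n).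
    rewrite ler_piMr// gerBl exprn_ge0// /rho; lra.
  elim: n => [|n IHn]; first by rewrite big_nil subrr mulr0.
  by rewrite big_nat_recr//= IHn exprS /rho; field.
move=> limE0; exists (lim_sup_set E); split => //.
  by apply: bigcapT_measurable => n; apply: bigcup_measurable => j _.
move=> w /= Vw; apply: contrapT => wE; apply: Vw.
have [m0 Em0] : exists m0, forall m, (m0 <= m)%N -> ~ E m w.
  apply: contrapT => /forallNP Ew; apply: wE => n _.
  have /existsNP[m /not_implyP[nm /contrapT Em]] := Ew n.
  by exists m.
apply/cvgrPdist_lt => e e0.
have [m1 m1e] : exists m1, forall m, (m1 <= m)%N -> 4 * (7 / 8) ^+ m < e.
  have /cvgrPdist_lt/(_ _ e0)[m1 _ Hm1] : 4 * (7 / 8 : R) ^+ m @[m --> \oo] --> (0 : R).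
    rewrite -[X in _ --> X](mulr0 4); apply: cvgMr; apply: cvg_expr.
    by rewrite ger0_norm; lra.
  exists m1 => m /Hm1; rewrite sub0r normrN; apply: le_lt_trans.
  exact: ler_norm.
exists (4 ^ (maxn m0 m1))%N => // n /= mn; rewrite sub0r normrN.
have n_gt0 : (0 < n)%N by apply: leq_trans mn; rewrite expn_gt0.
(* The block with 4^(m-1) <= n < 4^m. Dividing by n instead of 4^m costs the factor 4 that appears
   in [m1e]. *)
set m := (trunc_log 4 n).+1.
have [n_ge n_lt] : (4 ^ m.-1 <= n)%N /\ (n < 4 ^ m)%N.
  by have := @trunc_log_bounds 4 n isT n_gt0 => /andP[].
have mm : (maxn m0 m1 < m)%N by rewrite -(@ltn_exp2l 4)//; exact: leq_ltn_trans n_lt.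
move: mm; rewrite gtn_max => /andP[/ltnW m0m /ltnW m1m].
apply: le_lt_trans (m1e _ m1m).
have nS : `|\sum_(i < n) V i w| <= l m.
  by rewrite leNgt; apply/negP => /ltW ln; apply: (Em0 _ m0m); exists n => //; exact: ltnW.
rewrite normrM normfV normr_nat ler_pdivrMr ?ltr0n//; apply: (le_trans nS).
rewrite /l [leRHS]mulrAC ler_pM2r; last by apply: exprn_gt0; lra.
by rewrite exprS ler_pM2l// -natrX ler_nat.
Qed.

End martingale.

(** * Independence of discrete variables *)

Section independence.
Context {d : measure_display} {T : measurableType d} {R : realType}.
Variable P : probability T R.
Context {I : eqType}.
Variables (valid : pred I) (Z : I -> T -> nat).
Hypothesis mZ : forall i v, valid i -> measurable (Z i @^-1` [set v]).
Hypothesis indepZ : mutually_independent P valid Z.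

Lemma measurable_nat_rv (i : I) (B : set nat) : valid i ->
  measurable (Z i @^-1` B).
Proof.
move=> vi; apply: (@measurable_saturated _ _ _ (Z i)) => [v|w w' zw].
  exact: mZ.
by rewrite /preimage /= zw.
Qed.

Definition independent_of (G : pred I) (E : set T) :=
  measurable E /\ forall (F : seq I) (B : I -> set nat), uniq F -> all G F ->
    P (E `&` \bigcap_(i in [set i | i \in F]) (Z i @^-1` B i)) =
    (P E * \prod_(i <- F) P (Z i @^-1` B i))%E.

Let cylinder_cons (i : I) F (B : I -> set nat) :
  \bigcap_(j in [set j | j \in i :: F]) (Z j @^-1` B j) =
  Z i @^-1` B i `&` \bigcap_(j in [set j | j \in F]) (Z j @^-1` B j).
Proof.
apply/seteqP; split => [w wB|w [wi wF] j /=].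
  split; first by apply: wB; rewrite /= mem_head.
  by move=> j jF; apply: wB; rewrite /= in_cons jF orbT.
by rewrite in_cons => /predU1P[->//|]; exact: wF.
Qed.

Lemma independent_ofT (G : pred I) : subpred G valid -> independent_of G setT.
Proof.
move=> Gv; split => // F B uF GF; rewrite setTI probability_setT mul1e.
by apply: indepZ => //; apply: sub_all GF.
Qed.

Lemma independent_of_sub (G G' : pred I) E : subpred G' G ->
  independent_of G E -> independent_of G' E.
Proof.
move=> GG [mE iE]; split => // F B uF GF.
by apply: iE => //; apply: sub_all GF.
Qed.

Lemma independent_of0 (G : pred I) : independent_of G set0.
Proof. by split => // F B _ _; rewrite set0I measure0 mul0e. Qed.

Lemma independent_ofP (G : pred I) E i B : independent_of G E -> G i ->
  P (E `&` Z i @^-1` B) = (P E * P (Z i @^-1` B))%E.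
Proof.
move=> [_ /(_ [:: i] (fun=> B) isT)]; rewrite /= andbT big_seq1 => iE Gi.
rewrite -iE// cylinder_cons; congr (P (_ `&` _)).
by rewrite [X in _ `&` X](_ : _ = setT) ?setIT//; apply/seteqP; split.
Qed.

Lemma independent_of_preimage (G : pred I) E i B :
  independent_of G E -> G i -> valid i ->
  independent_of [pred j | G j && (j != i)] (E `&` Z i @^-1` B).
Proof.
move=> iE Gi vi; split.
  by apply: measurableI; [exact: iE.1|exact: measurable_nat_rv].
move=> F B' uF GF.
have iF : i \notin F by apply/negP => /(allP GF) /=; rewrite eqxx andbF.
(* Overriding the family at i is harmless because i does not occur in [F]; the cylinder over
   [i :: F] then handles both events at once. *)
pose C j := if j == i then B else B' j.
have CF : \bigcap_(j in [set j | j \in F]) (Z j @^-1` B' j) =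
    \bigcap_(j in [set j | j \in F]) (Z j @^-1` C j).
  apply: eq_bigcapr => j /= jF; rewrite /C.
  by case: eqP => // ji; rewrite -ji jF in iF.
have -> : (\prod_(j <- F) P (Z j @^-1` B' j) =
    \prod_(j <- F) P (Z j @^-1` C j))%E.
  apply: eq_big_seq => j jF; rewrite /C.
  by case: eqP => // ji; rewrite -ji jF in iF.
have CB : Z i @^-1` B = Z i @^-1` C i by rewrite /C eqxx.
rewrite (independent_ofP _ iE Gi) CF CB -setIA -cylinder_cons iE.2 ?big_cons ?muleA//.
- by rewrite /= iF.
- by rewrite /= Gi; apply: sub_all GF => j /= /andP[].
Qed.

(** Disjointness is what makes this work: the product formulas of the pieces can be added. *)
Lemma independent_of_bigsetU (G : pred I) n (A : 'I_n -> set T) :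
  subpred G valid -> trivIset setT A -> (forall v, independent_of G (A v)) ->
  independent_of G (\big[setU/set0]_(v < n) A v).
Proof.
move=> Gv tA iA; split.
  by apply: bigsetU_measurable => v _; case: (iA v).
move=> F B uF GF; set C := \bigcap_(i in _) _.
have mA v : measurable (A v) by case: (iA v).
have mC : measurable C.
  rewrite /C; elim: F GF {uF C} => [_|i F IHF /= /andP[Gi GF]].
    by rewrite [X in measurable X](_ : _ = setT)//; apply/seteqP; split.
  rewrite cylinder_cons; apply: measurableI; last exact: IHF.
  by apply: measurable_nat_rv; exact: Gv.
rewrite big_distrl/= !measure_semi_additive_ord//; last 4 first.
- by apply: bigsetU_measurable.
- by move=> v; exact: measurableI.
- exact: trivIset_setIr.
- by apply: bigsetU_measurable => v _; exact: measurableI.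
rewrite ge0_sume_distrl; last by move=> v _; exact: measure_ge0.
by apply: eq_bigr => v _; exact: (iA v).2.
Qed.

End independence.

(** * Integrals of natural-valued variables over independent events *)

Section nat_valued.
Context {d : measure_display} {T : measurableType d} {R : realType}.
Variable P : probability T R.

Lemma integral_nat_rv (Y : T -> nat) (E : set T) (phi : nat -> R) :
  (forall y, measurable (Y @^-1` [set y])) -> measurable E ->
  (forall y, 0 <= phi y) ->
  (\int[P]_(w in E) (phi (Y w))%:E =
    \sum_(y <oo) (phi y)%:E * P (E `&` Y @^-1` [set y]))%E.
Proof.
move=> mY mE phi0.
have UE : \bigcup_y (E `&` Y @^-1` [set y]) = E.
  by apply/seteqP; split => [w [y _ []]//|w Ew]; exists (Y w).
have mphi : measurable_fun setT (phi \o Y).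
  by apply: (measurable_fun_saturated mY) => w w' /= ->.
rewrite -[X in integral _ X _]UE ge0_integral_bigcup//; last 4 first.
- by move=> y; exact: measurableI.
- rewrite UE; apply/measurable_EFinP; exact: measurable_funTS.
- by move=> w _; rewrite lee_fin.
- by apply: trivIset_setIl => i j _ _ [w [/= <- <-]].
apply: eq_eseriesr => y _.
rewrite (eq_integral (cst (phi y)%:E)); last by move=> w; rewrite inE => -[_ /= ->].
by rewrite integral_cst//; exact: measurableI.
Qed.

Lemma ge0_integral_independent (Y : T -> nat) (E : set T) (phi : nat -> R) :
  (forall y, measurable (Y @^-1` [set y])) -> measurable E ->
  (forall y, P (E `&` Y @^-1` [set y]) = P E * P (Y @^-1` [set y]))%E ->
  (forall y, 0 <= phi y) ->
  (\int[P]_(w in E) (phi (Y w))%:E = P E * \int[P]_w (phi (Y w))%:E)%E.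
Proof.
move=> mY mE iE phi0; rewrite !integral_nat_rv//.
rewrite -[P E]fineK ?fin_num_measure//.
rewrite -nneseriesZl; last first.
  by move=> y _; rewrite mule_ge0 ?lee_fin ?measure_ge0.
apply: eq_eseriesr => y _.
by rewrite iE setTI fineK ?fin_num_measure// muleCA.
Qed.

Lemma Rintegral_independent (Y : T -> nat) (E : set T) (phi : nat -> R) :
  (forall y, measurable (Y @^-1` [set y])) -> measurable E ->
  (forall y, P (E `&` Y @^-1` [set y]) = P E * P (Y @^-1` [set y]))%E ->
  P.-integrable setT (EFin \o (fun w => phi (Y w))) ->
  \int[P]_(w in E) phi (Y w) = fine (P E) * \int[P]_w phi (Y w).
Proof.
move=> mY mE iE iphi.
(* Splitting [phi] into positive and negative parts reduces the claim to the nonnegative case. *)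
have parts (A : set T) : measurable A ->
    \int[P]_(w in A) phi (Y w) =
    \int[P]_(w in A) Num.max (phi (Y w)) 0 - \int[P]_(w in A) Num.max (- phi (Y w)) 0.
  move=> mA; rewrite -RintegralB//.
  - apply: eq_Rintegral => w _; rewrite maxEle maxEle.
    by case: (leP (phi _) 0) => ?; case: (leP (- phi _) 0) => ?; lra.
  - by apply: integrableS (integrable_funrpos measurableT iphi).
  - by apply: integrableS (integrable_funrneg measurableT iphi).
rewrite !parts// mulrBr /Rintegral.
rewrite (@ge0_integral_independent Y E (fun y => Num.max (phi y) 0))//; last first.
  by move=> y; rewrite le_max lexx orbT.
rewrite (@ge0_integral_independent Y E (fun y => Num.max (- phi y) 0))//; last first.
  by move=> y; rewrite le_max lexx orbT.
rewrite !fineM ?fin_num_measure//.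
- exact: integrable_fin_num (integrable_funrneg measurableT iphi).
- exact: integrable_fin_num (integrable_funrpos measurableT iphi).
Qed.

End nat_valued.

(** * The INAR(1) chain *)

Section inar_chain.
Context {d : measure_display} {T : measurableType d} {R : realType}.
Variable P : probability T R.
Variables (X0 : T -> nat) (eps : nat -> T -> nat) (xi : nat -> nat -> T -> nat).
Hypothesis mX0 : forall m, measurable (X0 @^-1` [set m]).
Hypothesis meps : forall k m, (0 < k)%N -> measurable (eps k @^-1` [set m]).
Hypothesis mxi : forall k j m, (0 < k)%N -> (0 < j)%N ->
  measurable (xi k j @^-1` [set m]).
Hypothesis indep : mutually_independent P inar_valid (inar_rv X0 eps xi).

Let Z := inar_rv X0 eps xi.
Let X := inarX X0 eps xi.

(** One step of the chain with the previous state frozen at x. The number of summands is then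
    deterministic, and independence of the primitive variables applies directly. *)
Definition inar_sum k x w := (\sum_(1 <= j < x.+1) xi k j w + eps k w)%N.

Lemma inar_sum0 k w : inar_sum k 0 w = eps k w.
Proof. by rewrite /inar_sum big_geq. Qed.

Lemma inar_sumS k x w : inar_sum k x.+1 w = (xi k x.+1 w + inar_sum k x w)%N.
Proof. by rewrite /inar_sum big_nat_recr//= addnCA addnA. Qed.

Let mZ i v : inar_valid i -> measurable (Z i @^-1` [set v]).
Proof.
by case: i => [[k|[k j]]|] /=; [exact: meps|move=> /andP[]; exact: mxi|].
Qed.

Let indep_of := independent_of P Z.

(** Convolution over the value v of the last thinning variable. *)
Lemma inar_sum_decomp (E : set T) k x y :
  E `&` inar_sum k x.+1 @^-1` [set y] = \big[setU/set0]_(v < y.+1)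
    ((E `&` xi k x.+1 @^-1` [set (v : nat)]) `&`
      inar_sum k x @^-1` [set (y - v)%N]).
Proof.
rewrite -(bigcup_mkord y.+1 (fun v => (E `&` xi k x.+1 @^-1` [set v]) `&`
  inar_sum k x @^-1` [set (y - v)%N])).
apply/seteqP; split => w /=.
  move=> [Ew]; rewrite inar_sumS => wy; exists (xi k x.+1 w) => /=; first by lia.
  by split => //; lia.
move=> [v /= vy [[Ew xv] Sw]]; split => //; rewrite inar_sumS xv Sw; lia.
Qed.

Let trivIset_decomp (E : set T) k x y :
  trivIset setT (fun v : 'I_y.+1 => (E `&` xi k x.+1 @^-1` [set (v : nat)]) `&`
      inar_sum k x @^-1` [set (y - v)%N]).
Proof.
move=> i j _ _ [w [[[_ /= wi] _] [[_ /= wj] _]]].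
by apply: val_inj; rewrite /= -wi -wj.
Qed.

(** The sum consumes [eps k] and the [xi k j] with j <= x, and [G'] must avoid all time-k indices.
    Induction on x peels off the last thinning variable, so [G] and [E] vary along the way. The
    product formula serves the current step, the independence from [G'] serves the next one. *)
Lemma independent_of_inar_sum k x (G G' : pred inar_idx) E : (0 < k)%N ->
  subpred G inar_valid -> indep_of G E ->
  G (Some (inl k)) -> (forall j, (0 < j <= x)%N -> G (Some (inr (k, j)))) ->
  subpred G' G -> ~~ G' (Some (inl k)) ->
  (forall j, ~~ G' (Some (inr (k, j)))) ->
  forall y, indep_of G' (E `&` inar_sum k x @^-1` [set y]) /\
    P (E `&` inar_sum k x @^-1` [set y]) =
    (P E * P (inar_sum k x @^-1` [set y]))%E.
Proof.
move=> k0; elim: x G E => [|x IHx] G E Gv iE Geps Gxi G'G G'eps G'xi y.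
  have -> : inar_sum k 0 = Z (Some (inl k)).
    by apply/funext => w; rewrite inar_sum0.
  split; last exact: independent_ofP iE Geps.
  apply: independent_of_sub (independent_of_preimage mZ [set y] iE Geps (Gv _ Geps)).
  move=> i G'i /=; rewrite (G'G _ G'i) /=; apply: contraNneq G'eps => <-//.
pose i0 : inar_idx := Some (inr (k, x.+1)).
have Gi0 : G i0 by apply: Gxi; rewrite /= leqnn.
pose H := [pred i | G i && (i != i0)].
have IH E' (v : nat) : indep_of G E' ->
    forall z, indep_of G' ((E' `&` xi k x.+1 @^-1` [set v]) `&`
      inar_sum k x @^-1` [set z]) /\
    P ((E' `&` xi k x.+1 @^-1` [set v]) `&` inar_sum k x @^-1` [set z]) =
    (P E' * (P (xi k x.+1 @^-1` [set v]) * P (inar_sum k x @^-1` [set z])))%E.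
  move=> iE' z.
  have iH : indep_of H (E' `&` xi k x.+1 @^-1` [set v]).
    exact: (independent_of_preimage mZ [set v] iE' Gi0 (Gv _ Gi0)).
  have [] := IHx H _ _ iH _ _ _ G'eps G'xi z.
  - by move=> i /andP[/Gv].
  - by rewrite /H /= Geps.
  - move=> j /andP[j0 jx]; rewrite /H /= Gxi ?j0 ?(leq_trans jx)//=.
    by apply/eqP => -[jx1]; rewrite jx1 ltnn in jx.
  - move=> i G'i; rewrite /H /= G'G//=.
    by apply: contraTneq G'i => ->; exact: G'xi.
  move=> iS ->; split => //.
  by rewrite (independent_ofP [set v] iE' Gi0) muleA.
(* Applied both to [E] and to the whole space, where the convolution is recognised as the law of the
   sum itself. *)
have PE E' : indep_of G E' -> P (E' `&` inar_sum k x.+1 @^-1` [set y]) =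
    (P E' * \sum_(v < y.+1) (P (xi k x.+1 @^-1` [set (v : nat)]) *
       P (inar_sum k x @^-1` [set (y - v)%N])))%E.
  move=> iE'; rewrite inar_sum_decomp measure_semi_additive_ord//.
  - rewrite ge0_sume_distrr; last by move=> v _; rewrite mule_ge0.
    by apply: eq_bigr => v _; exact: (IH _ _ _ _).2.
  - by move=> v; case: (IH E' v iE' (y - v)%N) => -[].
  - by apply: bigsetU_measurable => v _; case: (IH E' v iE' (y - v)%N) => -[].
split.
  rewrite inar_sum_decomp; apply: (independent_of_bigsetU mZ) => //.
    by move=> i /G'G /Gv.
  by move=> v; exact: (IH _ _ _ _).1.
rewrite PE// -[inar_sum _ _ @^-1` _]setTI PE ?probability_setT ?mul1e//.
exact: (independent_ofT indep Gv).
Qed.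

(** The whole history with the newest state at the head. Its values lie in the countable type
    [seq nat], so it can act as the filtration [c] of the strong law. *)
Fixpoint inar_path (k : nat) (w : T) : seq nat :=
  if k is k'.+1 then X k w :: inar_path k' w else [:: X 0%N w].

Lemma head_inar_path k w : head 0%N (inar_path k w) = X k w.
Proof. by case: k. Qed.

Lemma inar_path_le k w w' :
  inar_path k.+1 w = inar_path k.+1 w' -> inar_path k w = inar_path k w'.
Proof. by case. Qed.

Lemma inar_path_state k w w' :
  inar_path k w = inar_path k w' -> X k w = X k w'.
Proof. by move=> pw; rewrite -!head_inar_path pw. Qed.

Definition inar_time (i : inar_idx) : nat :=
  match i with None => 0%N | Some (inl k) => k | Some (inr (k, _)) => k end.

Definition after (k : nat) (i : inar_idx) :=
  inar_valid i && ((k < inar_time i)%N).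

Let after_valid k : subpred (after k) inar_valid.
Proof. by move=> i /andP[]. Qed.

Lemma inar_step_on_path k p y :
  inar_path k @^-1` [set p] `&` X k.+1 @^-1` [set y] =
  inar_path k @^-1` [set p] `&` inar_sum k.+1 (head 0%N p) @^-1` [set y].
Proof.
by apply/seteqP; split => w /= [<- <-]; split => //; rewrite head_inar_path.
Qed.

Let step_independent k p x y : indep_of (after k) (inar_path k @^-1` [set p]) ->
  indep_of (after k.+1) (inar_path k @^-1` [set p] `&` inar_sum k.+1 x @^-1` [set y]) /\
  P (inar_path k @^-1` [set p] `&` inar_sum k.+1 x @^-1` [set y]) =
    (P (inar_path k @^-1` [set p]) * P (inar_sum k.+1 x @^-1` [set y]))%E.
Proof.
move=> ip; apply: (@independent_of_inar_sum k.+1 x (after k)) => //=.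
- by rewrite /after /= ltnSn.
- by move=> j /andP[j0 _]; rewrite /after /= j0 ltnSn.
- by move=> i /andP[vi ki]; rewrite /after vi ltnW.
- by rewrite /after /= ltnn.
- by move=> j; rewrite /after /= ltnn andbF.
Qed.

(** On an atom of the history the current state is the constant [head 0%N p], so the next state is
    an [inar_sum] with a fixed number of terms, and independence from later variables carries over
    atom by atom. *)
Lemma independent_of_inar_path k p :
  indep_of (after k) (inar_path k @^-1` [set p]).
Proof.
elim: k p => [|k IHk] p.
  have [[x ->]|np] := pselect (exists x, p = [:: x]); last first.
    rewrite (_ : _ @^-1` _ = set0); first exact: independent_of0.
    by apply/seteqP; split => // w /= pE; apply: np; exists (X 0%N w).
  have -> : inar_path 0 @^-1` [set [:: x]] = setT `&` Z None @^-1` [set x].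
    by rewrite setTI; apply/seteqP; split => w /= => [[]|<-].
  apply: independent_of_sub (independent_of_preimage mZ [set x]
    (independent_ofT indep (fun i vi => vi)) _ _) => //.
  by case=> [i|]// /andP[vi _]; apply/andP.
case: p => [|y p].
  by rewrite (_ : _ @^-1` _ = set0); [exact: independent_of0|apply/seteqP; split].
have -> : inar_path k.+1 @^-1` [set y :: p] =
    inar_path k @^-1` [set p] `&` X k.+1 @^-1` [set y].
  by apply/seteqP; split => w /= => [[-> ->]|[-> ->]].
by rewrite inar_step_on_path; exact: (step_independent _ _ (IHk p)).1.
Qed.

Lemma measurable_inar_path k p : measurable (inar_path k @^-1` [set p]).
Proof. by case: (independent_of_inar_path k p). Qed.

Lemma measurable_inar k x : measurable (X k @^-1` [set x]).
Proof.
apply: (measurable_saturated (measurable_inar_path k)) => w w' pw /=.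
by rewrite (inar_path_state pw).
Qed.

Lemma measurable_inar_sum k x y : (0 < k)%N ->
  measurable (inar_sum k x @^-1` [set y]).
Proof.
case: k => // k _.
have iT : indep_of inar_valid setT := independent_ofT indep (fun i vi => vi).
rewrite -[X in measurable X]setTI.
have [] := @independent_of_inar_sum k.+1 x inar_valid (after k.+1) setT isT _ iT _ _ _ _ _ y.
- by [].
- by [].
- by move=> j /andP[j0 _] /=; rewrite j0.
- exact: after_valid.
- by rewrite /after /= ltnn.
- by move=> j; rewrite /after /= ltnn andbF.
by case.
Qed.

Lemma Rintegral_inar_path (phi : nat -> nat -> R) k p :
  P.-integrable setT (EFin \o
    (fun w => phi (head 0%N p) (inar_sum k.+1 (head 0%N p) w))) ->
  \int[P]_(w in inar_path k @^-1` [set p]) phi (X k w) (X k.+1 w) =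
  fine (P (inar_path k @^-1` [set p])) *
    \int[P]_w phi (head 0%N p) (inar_sum k.+1 (head 0%N p) w).
Proof.
move=> iphi; rewrite -(@Rintegral_independent _ _ _ _ _ _ (phi _))//.
- by apply: eq_Rintegral => w; rewrite inE /= => <-; rewrite head_inar_path.
- by move=> y; exact: measurable_inar_sum.
- exact: measurable_inar_path.
- by move=> y; exact: (step_independent _ _ (independent_of_inar_path k p)).2.
Qed.

Lemma ge0_integral_inar_step (phi : nat -> nat -> R) (K : nat -> R) k :
  (forall x y, 0 <= phi x y) -> (forall x, 0 <= K x) ->
  (forall x, \int[P]_w (phi x (inar_sum k.+1 x w))%:E = (K x)%:E)%E ->
  (\int[P]_w (phi (X k w) (X k.+1 w))%:E = \int[P]_w (K (X k w))%:E)%E.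
Proof.
move=> phi0 K0 phiK.
apply: (eq_ge0_integral_atoms (measurable_inar_path k)) => //.
- apply: (measurable_fun_saturated (measurable_inar_path k.+1)) => w w' pw.
  by rewrite (inar_path_state pw) (inar_path_state (inar_path_le pw)).
- apply: (measurable_fun_saturated (measurable_inar_path k)) => w w' pw.
  by rewrite (inar_path_state pw).
move=> p; set x := head 0%N p.
rewrite [LHS](eq_integral (fun w => (phi x (inar_sum k.+1 x w))%:E)); last first.
  by move=> w; rewrite inE /x /= => <-; rewrite head_inar_path.
rewrite [RHS](eq_integral (cst (K x)%:E)); last first.
  by move=> w; rewrite inE /x /= => <-; rewrite head_inar_path.
rewrite (@ge0_integral_independent _ _ _ _ _ _ (phi x))//.
- by rewrite phiK integral_cst; [rewrite muleC|exact: measurable_inar_path].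
- by move=> y; exact: measurable_inar_sum.
- exact: measurable_inar_path.
- by move=> y; exact: (step_independent _ _ (independent_of_inar_path k p)).2.
Qed.

End inar_chain.

(** * Moments computed from point probabilities *)

Section bernoulli_moments.
Context {d : measure_display} {T : measurableType d} {R : realType}.
Variable P : probability T R.

Lemma integral_bernoulli (Y : T -> nat) (a : R) (phi : nat -> R) :
  (forall y, measurable (Y @^-1` [set y])) ->
  P (Y @^-1` [set 1%N]) = a%:E -> P (Y @^-1` [set 0%N]) = (1 - a)%:E ->
  (forall y, 0 <= phi y) ->
  (\int[P]_w (phi (Y w))%:E = (a * phi 1%N + (1 - a) * phi 0%N)%:E)%E.
Proof.
move=> mY P1 P0 phi0; rewrite integral_nat_rv//.
(* The masses at 0 and 1 already add up to 1. *)
have PY y : P (Y @^-1` [set y.+2]) = 0%E.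
  apply/eqP; rewrite eq_le measure_ge0 andbT.
  have mY01 : measurable (Y @^-1` [set 0%N] `|` Y @^-1` [set 1%N]).
    exact: measurableU.
  have : (P (Y @^-1` [set y.+2]) <=
      P (~` (Y @^-1` [set 0%N] `|` Y @^-1` [set 1%N])))%E.
    apply: le_measure; rewrite ?inE//; first exact: measurableC.
    by move=> w /= Yw [|]; rewrite Yw.
  have PU : (P (Y @^-1` [set 0%N] `|` Y @^-1` [set 1%N]) =
      P (Y @^-1` [set 0%N]) + P (Y @^-1` [set 1%N]))%E.
    by apply: measureU => //; apply/seteqP; split => // w [/= ->].
  rewrite probability_setC// PU P0 P1.
  suff -> : (1 - ((1 - a)%:E + a%:E) = 0)%E by [].
  by congr EFin; rewrite subrK subrr.
rewrite (nneseries_split 0%N 2%N)//=; last first.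
  by move=> k _; rewrite mule_ge0 ?lee_fin.
rewrite eseries0 ?adde0; last first.
  by case=> [|[|k]]// _ _; rewrite setTI PY mule0.
rewrite big_nat_recl// big_nat1 !setTI.
rewrite P0 P1 -!EFinM -EFinD; congr EFin; ring.
Qed.

Lemma eq_integral_nat_rv (Y Y' : T -> nat) (phi : nat -> R) :
  (forall y, measurable (Y @^-1` [set y])) ->
  (forall y, measurable (Y' @^-1` [set y])) ->
  (forall y, P (Y @^-1` [set y]) = P (Y' @^-1` [set y])) ->
  (forall y, 0 <= phi y) ->
  (\int[P]_w (phi (Y w))%:E = \int[P]_w (phi (Y' w))%:E)%E.
Proof.
move=> mY mY' YY' phi0; rewrite !integral_nat_rv//.
by apply: eq_eseriesr => y _; rewrite !setTI YY'.
Qed.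

Lemma square_integrable_nat_rv (Y : T -> nat) :
  (forall y, measurable (Y @^-1` [set y])) ->
  (\int[P]_w (((Y w)%:R : R) ^+ 2)%:E < +oo)%E ->
  square_integrable P (fun w => (Y w)%:R).
Proof.
move=> mY Yoo.
have mYR : measurable_fun setT (fun w => (Y w)%:R : R).
  by apply: (measurable_fun_saturated mY) => w w' ->.
split => //; apply/integrableP; split.
  by apply/measurable_EFinP; exact: measurable_funX.
apply: le_lt_trans Yoo; apply: ge0_le_integral => //=.
- apply/measurable_EFinP; apply: measurableT_comp => //.
  exact: measurable_funX.
- by apply/measurable_EFinP; exact: measurable_funX.
- by move=> w _; rewrite lee_fin ger0_norm ?sqr_ge0.
Qed.

End bernoulli_moments.

Lemma variance_bound (R : realFieldType) (a s x : R) :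
  0 < a < 1 -> 0 <= s -> 0 <= x -> x * (a * (1 - a)) + s <= x + s.
Proof.
move=> /andP[a0 a1] s0 x0; rewrite lerD2r ler_piMr// mulr_ile1 ?ltW//; lra.
Qed.

(** * Second moments, laws of large numbers and change frequency of the chain *)

Section inar_moments.
Context {d : measure_display} {T : measurableType d} {R : realType}.
Variable P : probability T R.
Variables (X0 : T -> nat) (eps : nat -> T -> nat) (xi : nat -> nat -> T -> nat).
Variable alpha : R.
Hypothesis alpha01 : 0 < alpha < 1.
Hypothesis mX0 : forall m, measurable (X0 @^-1` [set m]).
Hypothesis meps : forall k m, (0 < k)%N -> measurable (eps k @^-1` [set m]).
Hypothesis mxi : forall k j m, (0 < k)%N -> (0 < j)%N ->
  measurable (xi k j @^-1` [set m]).
Hypothesis indep : mutually_independent P inar_valid (inar_rv X0 eps xi).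
Hypothesis eps_id : forall k m, (0 < k)%N ->
  P (eps k @^-1` [set m]) = P (eps 1%N @^-1` [set m]).
Hypothesis eps_sqr : (\int[P]_w (((eps 1%N w)%:R : R) ^+ 2)%:E < +oo)%E.
Hypothesis eps_neq0 : (0 < P [set w | eps 1%N w != 0%N])%E.
Hypothesis xi_bern : forall k j, (0 < k)%N -> (0 < j)%N ->
  P [set w | xi k j w = 1%N] = alpha%:E /\
  P [set w | xi k j w = 0%N] = (1 - alpha)%:E.
Hypothesis X0_sqr : (\int[P]_w (((X0 w)%:R : R) ^+ 2)%:E < +oo)%E.

Let mu : R := fine (\int[P]_w ((eps 1%N w)%:R : R)%:E).
Let sigma2 : R := \int[P]_w (((eps 1%N w)%:R - mu) ^+ 2).
Let X := inarX X0 eps xi.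
Let S := inar_sum eps xi.
Let mS k x y : (0 < k)%N -> measurable (S k x @^-1` [set y]).
Proof. exact: (measurable_inar_sum mX0 meps mxi indep). Qed.

Lemma EFin_Rintegral (f : T -> R) : P.-integrable setT (EFin \o f) ->
  (\int[P]_w (f w)%:E = (\int[P]_w f w)%:E)%E.
Proof. by move=> if_; rewrite fineK// integrable_fin_num. Qed.

Let eps_integral k (phi : nat -> R) : (0 < k)%N -> (forall y, 0 <= phi y) ->
  (\int[P]_w (phi (eps k w))%:E = \int[P]_w (phi (eps 1%N w))%:E)%E.
Proof.
move=> k0 phi0; apply: eq_integral_nat_rv => // y; [exact: meps|exact: meps|].
exact: eps_id.
Qed.

Let eps_L2 k : (0 < k)%N -> square_integrable P (fun w => (eps k w)%:R).
Proof.
move=> k0; apply: square_integrable_nat_rv; first by move=> y; exact: meps.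
by rewrite (@eps_integral k (fun y => y%:R ^+ 2))// => y; exact: sqr_ge0.
Qed.

Let cst_integral (r : R) : \int[P]_w r = r.
Proof.
by rewrite Rintegral_cst// [X in fine X](@probability_setT _ _ _ P) mulr1.
Qed.

Let Rintegral_sub_cst (f : T -> R) (r : R) : square_integrable P f ->
  \int[P]_w (f w - r) = \int[P]_w f w - r.
Proof.
move=> sf; rewrite RintegralB// ?cst_integral//.
  exact: square_integrable_integrable.
exact: square_integrable_integrable (square_integrable_cst P r).
Qed.

Definition inar_error k x w : R := (S k x w)%:R - (alpha * x%:R + mu).

Let xi_L2 k j : (0 < k)%N -> (0 < j)%N ->
  [/\ square_integrable P (fun w => (xi k j w)%:R - alpha),
      \int[P]_w ((xi k j w)%:R - alpha) = 0 &
      \int[P]_w (((xi k j w)%:R - alpha) ^+ 2) = alpha * (1 - alpha)].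
Proof.
move=> k0 j0; have [P1 P0] := xi_bern k0 j0.
have xiE phi := integral_bernoulli (fun y => mxi y k0 j0) P1 P0 (phi := phi).
have sxi : square_integrable P (fun w => (xi k j w)%:R).
  apply: square_integrable_nat_rv; first by move=> y; exact: mxi.
  rewrite (xiE (fun y => y%:R ^+ 2)); last by move=> y; exact: sqr_ge0.
  by rewrite ltry.
split.
- exact: square_integrableB sxi (square_integrable_cst P alpha).
- rewrite Rintegral_sub_cst// /Rintegral (xiE (fun y => y%:R)) /=; first by ring.
  by move=> y; exact: ler0n.
- rewrite /Rintegral (xiE (fun y => (y%:R - alpha) ^+ 2)) /=; first by ring.
  by move=> y; exact: sqr_ge0.
Qed.

Lemma xi_inar_sum_independent k x v y : (0 < k)%N ->
  P (xi k x.+1 @^-1` [set v] `&` S k x @^-1` [set y]) =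
  (P (xi k x.+1 @^-1` [set v]) * P (S k x @^-1` [set y]))%E.
Proof.
move=> k0; pose i0 : inar_idx := Some (inr (k, x.+1)).
have mZ i m : inar_valid i -> measurable (inar_rv X0 eps xi i @^-1` [set m]).
  by case: i => [[i|[i j]]|] /=; [exact: meps|move=> /andP[]; exact: mxi|].
have vi0 : inar_valid i0 by rewrite /= k0.
have iT : independent_of P (inar_rv X0 eps xi) inar_valid setT.
  exact: (independent_ofT indep (fun i vi => vi)).
have iE := independent_of_preimage mZ [set v] iT vi0 vi0.
rewrite setTI in iE.
apply: (independent_of_inar_sum mX0 meps mxi indep k0 _ iE (G' := pred0) _ _ _ _ _ y).2 => //=.
- by move=> i /andP[].
- move=> j /andP[j0 jx]; rewrite k0 j0/=.
  by apply/eqP => -[jx1]; rewrite jx1 ltnn in jx.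
Qed.

(** Each further unit of x adds a centred Bernoulli variable independent of the rest, so the
    variances add. This gives the conditional mean and variance of the next state. *)
Lemma inar_error_moments k x : (0 < k)%N ->
  [/\ square_integrable P (inar_error k x),
      \int[P]_w inar_error k x w = 0 &
      \int[P]_w (inar_error k x w ^+ 2) = x%:R * (alpha * (1 - alpha)) + sigma2].
Proof.
move=> k0; elim: x => [|x [IH1 IH2 IH3]].
  have E w : inar_error k 0 w = (eps k w)%:R - mu.
    by rewrite /inar_error /S inar_sum0 mulr0 add0r.
  rewrite (_ : inar_error k 0 = fun w => (eps k w)%:R - mu); last exact/funext.
  split.
  - exact: square_integrableB (eps_L2 k0) (square_integrable_cst P mu).
  - rewrite Rintegral_sub_cst; last exact: (eps_L2 k0).
    rewrite /Rintegral (@eps_integral k (fun y => y%:R) k0); last first.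
      by move=> y; exact: ler0n.
    exact: subrr.
  - rewrite mul0r add0r /sigma2 /Rintegral.
    rewrite (@eps_integral k (fun y => (y%:R - mu) ^+ 2))// => y.
    exact: sqr_ge0.
have [xi1 xi2 xi3] := xi_L2 k0 (ltn0Sn x).
have -> : inar_error k x.+1 =
    fun w => ((xi k x.+1 w)%:R - alpha) + inar_error k x w.
  by apply/funext => w; rewrite /inar_error /S inar_sumS natrD mulrSr; ring.
have orth : \int[P]_w (((xi k x.+1 w)%:R - alpha) * inar_error k x w) = 0.
  apply: (Rintegral_orthogonal (c := xi k x.+1)).
  - by move=> v; exact: mxi.
  - by move=> w w' ->.
  - exact: square_integrable_integrable.
  - move=> v; rewrite (@Rintegral_independent _ _ _ P (S k x) _
      (fun y => y%:R - (alpha * x%:R + mu))).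
    + by rewrite [X in _ * X]IH2 mulr0.
    + by move=> y; exact: mS.
    + exact: mxi.
    + by move=> y; exact: xi_inar_sum_independent.
    + exact: square_integrable_integrable.
  - exact: square_integrable_mul.
split.
- exact: square_integrableD.
- rewrite RintegralD//; try exact: square_integrable_integrable.
  by rewrite xi2 IH2 addr0.
- by rewrite Rintegral_sqrD// xi3 IH3 mulrSr; ring.
Qed.

Lemma sigma2_ge0 : 0 <= sigma2.
Proof. by apply: Rintegral_ge0 => w _; exact: sqr_ge0. Qed.

Let K (x : nat) : R :=
  (alpha * x%:R + mu) ^+ 2 + x%:R * (alpha * (1 - alpha)) + sigma2.

Let K_ge0 x : 0 <= K x.
Proof.
have /andP[a0 a1] := alpha01; rewrite !addr_ge0 ?sqr_ge0 ?sigma2_ge0//.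
by rewrite !mulr_ge0 ?subr_ge0// ltW.
Qed.

Lemma inar_sum_sqr k x : (0 < k)%N ->
  square_integrable P (fun w => (S k x w)%:R) /\
  \int[P]_w ((S k x w)%:R ^+ 2) = K x.
Proof.
move=> k0; have [D1 D2 D3] := inar_error_moments x k0.
set m := alpha * x%:R + mu.
have sm := square_integrable_cst P m.
have -> : (fun w => (S k x w)%:R) = (fun w => inar_error k x w + cst m w).
  by apply/funext => w; rewrite /inar_error -/m /= subrK.
split; first exact: square_integrableD.
have -> : (fun w => (S k x w)%:R ^+ 2) = (fun w => (inar_error k x w + cst m w) ^+ 2).
  by apply/funext => w; rewrite /inar_error -/m /= subrK.
rewrite Rintegral_sqrD//; last first.
  rewrite RintegralZr//; first by rewrite D2 mul0r.
  exact: square_integrable_integrable.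
by rewrite D3 /= cst_integral /K -/m; ring.
Qed.

(** [K] is quadratic with leading coefficient alpha^2 < 1. Raising that coefficient to (1 + alpha^2)
    / 2, still below 1, leaves the slack [e], which absorbs the linear term b x by completing the
    square. *)
Let K_bound : exists2 C : R, 0 <= C &
  forall x, K x <= (1 + alpha ^+ 2) / 2 * x%:R ^+ 2 + C.
Proof.
have /andP[a0 a1] := alpha01.
pose b := 2 * alpha * mu + alpha * (1 - alpha).
pose e := (1 - alpha ^+ 2) / 2.
have e0 : 0 < e by rewrite divr_gt0// subr_gt0 expr_lt1// ltW.
exists (mu ^+ 2 + sigma2 + b ^+ 2 / (4 * e)).
  rewrite !addr_ge0 ?sqr_ge0 ?sigma2_ge0// divr_ge0 ?sqr_ge0//.
  by rewrite mulr_ge0// ltW.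
move=> x; rewrite -subr_ge0.
rewrite (_ : _ - _ = (2 * e * x%:R - b) ^+ 2 / (4 * e)).
  by rewrite divr_ge0 ?sqr_ge0// mulr_ge0// ltW.
rewrite /K; apply: (mulIf (lt0r_neq0 e0)).
rewrite /b /e; field.
by move: e0; rewrite /e => e0; apply/eqP; lra.
Qed.

Let ge0_Rintegral_inar_step (phi : nat -> nat -> R) (L : nat -> R) k :
  (forall x y, 0 <= phi x y) -> (forall x, 0 <= L x) ->
  (forall x, P.-integrable setT (EFin \o (fun w => phi x (S k.+1 x w)))) ->
  (forall x, \int[P]_w phi x (S k.+1 x w) = L x) ->
  (\int[P]_w (phi (X k w) (X k.+1 w))%:E = \int[P]_w (L (X k w))%:E)%E.
Proof.
move=> phi0 L0 iphi phiL.
apply: (ge0_integral_inar_step mX0 meps mxi indep) => // x.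
by rewrite -phiL EFin_Rintegral.
Qed.

Let saturated_measurable k (f : nat -> R) : measurable_fun setT (fun w => f (X k w)).
Proof.
apply: (measurable_fun_saturated (measurable_inar mX0 meps mxi indep k)).
by move=> w w' /= xw; rewrite /X xw.
Qed.

Let int_quadratic k (a b : R) : square_integrable P (fun w => (X k w)%:R) ->
  P.-integrable setT (EFin \o (fun w => a * (X k w)%:R ^+ 2 + b)) /\
  \int[P]_w (a * (X k w)%:R ^+ 2 + b) = a * \int[P]_w ((X k w)%:R ^+ 2) + b.
Proof.
move=> sX.
have i1 : P.-integrable setT (EFin \o (fun w => a * (X k w)%:R ^+ 2)).
  by apply: eq_integrable (integrableZl measurableT a sX.2).
have i2 := finite_measure_integrable_cst P b measurableT.
split; first by apply: eq_integrable (integrableD measurableT i1 i2).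
by rewrite RintegralD// RintegralZl ?cst_integral//; exact: sX.2.
Qed.

Lemma inar_second_moments : exists2 B : R, 0 <= B & forall k,
  square_integrable P (fun w => (X k w)%:R) /\
  \int[P]_w ((X k w)%:R ^+ 2) <= B.
Proof.
have /andP[a0 a1] := alpha01.
have [C C0 KC] := K_bound.
pose e := (1 - alpha ^+ 2) / 2.
have e0 : 0 < e by rewrite divr_gt0// subr_gt0 expr_lt1// ltW.
have sX0 : square_integrable P (fun w => (X 0 w)%:R).
  exact: square_integrable_nat_rv.
set m0 := \int[P]_w ((X 0 w)%:R ^+ 2).
have m0_ge0 : 0 <= m0 by apply: Rintegral_ge0 => w _; exact: sqr_ge0.
(* The moments satisfy m_{k+1} <= (1 - e) m_k + C. The affine map has fixed point C / e, so the
   bound m0 + C / e reproduces itself. *)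
exists (m0 + C / e); first by rewrite addr_ge0// divr_ge0// ltW.
elim=> [|k [IH1 IH2]]; first by split=> //; rewrite lerDl divr_ge0// ltW.
have stepE : (\int[P]_w ((X k.+1 w)%:R ^+ 2)%:E = \int[P]_w (K (X k w))%:E)%E.
  apply: (ge0_Rintegral_inar_step (phi := fun _ y => y%:R ^+ 2)) => //.
  - by move=> x; case: (@inar_sum_sqr k.+1 x isT) => -[_ h] _; exact: h.
  - by move=> x; case: (@inar_sum_sqr k.+1 x isT) => _; exact.
have [iq qE] := int_quadratic ((1 + alpha ^+ 2) / 2) C IH1.
have KE : (\int[P]_w (K (X k w))%:E <=
    (((1 + alpha ^+ 2) / 2) * \int[P]_w ((X k w)%:R ^+ 2) + C)%:E)%E.
  rewrite -qE -EFin_Rintegral//; apply: ge0_le_integral => //.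
  - by move=> w _; rewrite lee_fin.
  - by apply/measurable_EFinP; exact: saturated_measurable.
  - exact: measurable_int iq.
  - by move=> w _; rewrite lee_fin.
have sXk : square_integrable P (fun w => (X k.+1 w)%:R).
  apply: square_integrable_nat_rv => //.
    exact: (measurable_inar mX0 meps mxi indep).
  by rewrite stepE; apply: le_lt_trans KE _; rewrite ltry.
split => //; move: KE; rewrite -stepE EFin_Rintegral ?lee_fin; last exact: sXk.2.
move/le_trans; apply.
apply: (@le_trans _ _ ((1 + alpha ^+ 2) / 2 * (m0 + C / e) + C)).
  by rewrite lerD2r ler_wpM2l// divr_ge0// addr_ge0// sqr_ge0.
rewrite -subr_ge0.
rewrite (_ : _ - _ = e * m0); first by rewrite mulr_ge0// ltW.
rewrite /e; field; by move: e0; rewrite /e => e0; apply/eqP; lra.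
Qed.

Definition inar_residual k w : R :=
  (X k.+1 w)%:R - (alpha * (X k w)%:R + mu).

Let path := inar_path X0 eps xi.
Let m_path k p : measurable (path k @^-1` [set p]).
Proof. exact: (measurable_inar_path mX0 meps mxi indep). Qed.

Let md := martingale_difference P path.

Let residual_L2 k : square_integrable P (inar_residual k).
Proof.
have [B _ XB] := inar_second_moments.
apply: square_integrableB; first exact: (XB k.+1).1.
apply: square_integrableD (square_integrable_cst P mu).
exact: square_integrableZ (XB k).1.
Qed.

Let weighted_saturated (g : nat -> R) k w w' : path k.+1 w = path k.+1 w' ->
  g (X k w) * inar_residual k w = g (X k w') * inar_residual k w'.
Proof.
move=> pw; rewrite /inar_residual /X (inar_path_state pw).
by rewrite (inar_path_state (inar_path_le pw)).
Qed.

Let weighted_L2 (g : nat -> R) (G : R) k : (forall x, `|g x| <= G) ->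
  square_integrable P (fun w => g (X k w) * inar_residual k w).
Proof.
move=> gG; apply: (square_integrable_le _ _ (square_integrableZ G (residual_L2 k))).
  by apply: measurable_funM; [exact: saturated_measurable|exact: (residual_L2 k).1].
move=> w; rewrite !exprMn ler_wpM2r ?sqr_ge0//.
rewrite -(real_normK (num_real (g _))) lerXn2r// nnegrE//.
exact: le_trans (gG 0%N).
Qed.

Lemma martingale_difference_residual (g : nat -> R) (G : R) :
  (forall x, `|g x| <= G) -> md (fun k w => g (X k w) * inar_residual k w).
Proof.
move=> gG; split.
- by move=> k w w'; exact: weighted_saturated.
- by move=> k; exact: weighted_L2 gG.
move=> k p; have [D1 D2 _] := inar_error_moments (head 0%N p) (ltn0Sn k).
have iD := square_integrable_integrable D1.
rewrite [LHS](Rintegral_inar_path mX0 meps mxi indep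
  (phi := fun x y => g x * (y%:R - (alpha * x%:R + mu)))).
  by rewrite [X in _ * X]RintegralZl// [X in _ * (_ * X)]D2 !mulr0.
by apply: eq_integrable (integrableZl measurableT (g (head 0%N p)) iD).
Qed.

(** Given state x the weighted residual has second moment g(x)^2 (x alpha (1 - alpha) + sigma2).
    Only a quadratic majorant of this can be integrated with the two available moments. *)
Lemma weighted_residual_sqr (g : nat -> R) (G A B : R) k :
  (forall x, `|g x| <= G) -> 0 <= A ->
  (forall x, g x ^+ 2 * (x%:R * (alpha * (1 - alpha)) + sigma2) <=
    A * x%:R ^+ 2 + A) ->
  \int[P]_w ((X k w)%:R ^+ 2) <= B ->
  \int[P]_w ((g (X k w) * inar_residual k w) ^+ 2) <= A * (B + 1).
Proof.
move=> gG A0 gA XB; have /andP[a0 a1] := alpha01.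
have [B' _ XB'] := inar_second_moments.
have [iq qE] := int_quadratic A A (XB' k).1.
apply: (@le_trans _ _ (A * \int[P]_w ((X k w)%:R ^+ 2) + A)); last first.
  by rewrite mulrDr mulr1 lerD2r ler_wpM2l.
rewrite -lee_fin -EFin_Rintegral; last exact: (weighted_L2 k gG).2.
rewrite -qE -(EFin_Rintegral iq).
pose L x : R := g x ^+ 2 * (x%:R * (alpha * (1 - alpha)) + sigma2).
have L0 x : 0 <= L x.
  rewrite mulr_ge0 ?sqr_ge0// addr_ge0 ?sigma2_ge0//.
  by rewrite !mulr_ge0 ?subr_ge0// ltW.
rewrite [leLHS](ge0_Rintegral_inar_step
  (phi := fun x y => (g x * (y%:R - (alpha * x%:R + mu))) ^+ 2) _ L0).
- apply: ge0_le_integral => //.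
  + by move=> w _; rewrite lee_fin.
  + by apply/measurable_EFinP; exact: (saturated_measurable k L).
  + exact: measurable_int iq.
  + by move=> w _; rewrite lee_fin; exact: gA.
- by move=> x y; exact: sqr_ge0.
- move=> x; have [D1 _ _] := inar_error_moments x (ltn0Sn k).
  exact: (square_integrableZ (g x) D1).2.
- move=> x; have [D1 _ D3] := inar_error_moments x (ltn0Sn k).
  under eq_Rintegral => w _ do rewrite exprMn.
  by rewrite RintegralZl ?[X in _ * X]D3//; exact: D1.2.
Qed.

Let p_le : forall k w w', path k.+1 w = path k.+1 w' -> path k w = path k w'.
Proof. by move=> k w w'; exact: inar_path_le. Qed.

Lemma residual_law_of_large_numbers :
  {ae P, forall w, (\sum_(i < n) inar_residual i w) / n%:R @[n --> \oo] --> (0 : R)}.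
Proof.
have [B B0 XB] := inar_second_moments.
have /andP[a0 a1] := alpha01.
pose C := (1 + sigma2) * (B + 1).
have C0 : 0 <= C by rewrite mulr_ge0// addr_ge0// sigma2_ge0.
have g1 (x : nat) : `|1 : R| <= 1 by rewrite normr1.
have E : inar_residual = fun k w => 1 * inar_residual k w.
  by apply/funext => k; apply/funext => w; rewrite mul1r.
(* With constant weight nothing needs truncation: the exceptional events are empty and the second
   moments stay below C. *)
apply: (strong_law m_path p_le (Vt := fun=> inar_residual) (C := C)).
- by rewrite E; exact: (weighted_saturated (fun=> 1)).
- by move=> _; rewrite E; exact: (martingale_difference_residual g1).
- move=> m i; apply: (@le_trans _ _ C); last first.
    by rewrite ler_peMr// exprn_ege1// ler1n.
  rewrite E; apply: (weighted_residual_sqr g1) => //.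
  + by rewrite addr_ge0// sigma2_ge0.
  + move=> x; rewrite expr1n mul1r.
    apply: le_trans (variance_bound alpha01 sigma2_ge0 (ler0n _ x)) _.
    rewrite [leRHS](_ : _ = (x%:R ^+ 2 + sigma2) + (sigma2 * x%:R ^+ 2 + 1)); last by ring.
    rewrite ler_wpDr ?lerD2r ?addr_ge0 ?mulr_ge0 ?sqr_ge0 ?sigma2_ge0//.
    by rewrite -natrX ler_nat; case: x => // x; rewrite leq_pmulr.
  + exact: (XB i).2.
- move=> m; rewrite (_ : [set w | _] = set0) ?measure0.
    by rewrite lee_fin mulr_ge0// exprn_ge0//; lra.
  by apply/seteqP; split => // w [k _]; rewrite eqxx.
Qed.

Lemma weighted_residual_law_of_large_numbers :
  {ae P, forall w,
    (\sum_(i < n) (X i w)%:R * inar_residual i w) / n%:R @[n --> \oo] --> (0 : R)}.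
Proof.
have [B B0 XB] := inar_second_moments.
have /andP[a0 a1] := alpha01.
pose C := (1 + sigma2) * (B + 1).
have s0 := sigma2_ge0.
have C0 : 0 <= C by rewrite mulr_ge0// addr_ge0.
pose g m (x : nat) : R := if (x <= 3 ^ m)%N then x%:R else 0.
have gG m x : `|g m x| <= 3 ^+ m.
  rewrite /g; case: ifP => [x3|_]; last by rewrite normr0 exprn_ge0.
  by rewrite normr_nat -natrX ler_nat.
apply: (strong_law m_path p_le (V := fun k w => (X k w)%:R * inar_residual k w)
  (Vt := fun m k w => g m (X k w) * inar_residual k w) (C := C)).
- by move=> n w w'; exact: (weighted_saturated (fun x => x%:R)).
- by move=> m; exact: (martingale_difference_residual (gG m)).
- move=> m i.
  have M1 : 1 <= (3 : R) ^+ m by rewrite exprn_ege1// ler1n.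
  have M0 := le_trans ler01 M1.
  rewrite /C mulrAC; apply: (weighted_residual_sqr (gG m)) (XB i).2.
    by rewrite mulr_ge0// addr_ge0.
  move=> x; rewrite /g; case: ifP => [x3|_]; last first.
    by rewrite expr0n mul0r addr_ge0 ?mulr_ge0 ?sqr_ge0// addr_ge0.
  (* The second moment is at most x^2 (x + sigma2). The truncation pays for the third factor x,
     leaving (1 + sigma2) 3^m x^2. *)
  have xM : (x%:R : R) <= 3 ^+ m by rewrite -natrX ler_nat.
  rewrite ler_wpDr ?mulr_ge0 ?addr_ge0// mulrC ler_wpM2r ?sqr_ge0//.
  apply: le_trans (variance_bound alpha01 s0 (ler0n _ x)) _.
  by rewrite mulrDl mul1r lerD// ler_peMr.
- move=> m.
  (* Truncation changes a term only on some [A k] with k < 4^m; each has probability at most B / 9^m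
     by Chebyshev's inequality. *)
  pose A k := [set w | (3 ^+ m : R) <= `|(X k w)%:R|].
  have mA k : measurable (A k).
    rewrite /A (_ : [set w | _] = \bigcup_(x in [set x : nat | (3 ^+ m : R) <= `|x%:R|]) X k @^-1` [set x]).
      by apply: bigcup_measurable => x _; exact: (measurable_inar mX0 meps mxi indep).
    by apply/seteqP; split => [w ?|w [x /= ? ->]//]; exists (X k w).
  have PA k : (P (A k) <= (B / 9 ^+ m)%:E)%E.
    apply: le_trans (chebyshev_sqr _ (XB k).1) _; first exact: exprn_gt0.
    rewrite lee_fin -exprM mulnC exprM (_ : 3 ^+ 2 = 9); last by ring.
    by rewrite ler_pM2r ?invr_gt0 ?exprn_gt0//; exact: (XB k).2.
  apply: (@le_trans _ _ (P (\bigcup_(k < 4 ^ m) A k))).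
    apply: le_measure; rewrite ?inE.
    + apply: (measurable_saturated (m_path (4 ^ m))) => w w' pw [k km Vk].
      exists k => //; move: Vk.
      have pk : path k.+1 w = path k.+1 w'.
        move: km pw; elim: (4 ^ m)%N => // N IHN.
        by rewrite ltnS leq_eqVlt => /predU1P[->//|/IHN + /p_le]; apply.
      by rewrite (weighted_saturated (fun x => x%:R) pk)
        (weighted_saturated (g m) pk).
    + by apply: bigcup_measurable => k _.
    + move=> w [k km]; rewrite /g; case: leqP => [_|x3 _]; first by rewrite eqxx.
      by exists k => //; rewrite /A /= normr_nat -natrX ler_nat ltnW.
  rewrite bigcup_mkord.
  apply: (@le_trans _ _ (\sum_(k < 4 ^ m) (B / 9 ^+ m)%:E)%E).
    elim: (4 ^ m)%N => [|N IHN]; first by rewrite !big_ord0 measure0.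
    rewrite !big_ord_recr /=; apply: le_trans (leeD IHN (PA N)).
    by apply: measureU2 => //; exact: bigsetU_measurable.
  rewrite sumEFin lee_fin sumr_const card_ord -[leLHS]mulr_natl natrX.
  rewrite mulrCA -expr_div_n; apply: ler_wpM2r.
    by rewrite exprn_ge0// divr_ge0.
  rewrite /C; nra.
Qed.

Let indicator_L2 (b : T -> bool) : measurable_fun setT (fun w => (b w)%:R : R) ->
  square_integrable P (fun w => (b w)%:R).
Proof.
move=> mb; apply: (square_integrable_le mb _ (square_integrable_cst P 1)) => w /=.
by rewrite [leRHS]expr1n -[leLHS]natrX lern1; case: (b w).
Qed.

Let neq_L2 k x y : square_integrable P (fun w => (S k.+1 x w != y)%:R).
Proof.
apply: indicator_L2.
by apply: (measurable_fun_saturated (fun z => mS x z (ltn0Sn k))) => w w' ->.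
Qed.

Let neq_int k x y := square_integrable_integrable (neq_L2 k x y).

Let change_prob k x := \int[P]_w (S k.+1 x w != x)%:R : R.

(** From state 0 a change means a nonzero innovation. From x + 1, split on the last thinning
    variable: if it is 0 the state changes when [S k.+1 x] differs from x + 1, if it is 1 when
    [S k.+1 x] differs from x. At least one of these inequalities always holds, whence the bound
    min(alpha, 1 - alpha). *)
Lemma inar_change_prob_lb : exists2 p : R, 0 < p & forall k x, p <= change_prob k x.
Proof.
have /andP[a0 a1] := alpha01.
pose q : R := \int[P]_w (eps 1%N w != 0%N)%:R.
have q0 : 0 < q.
  have mE : measurable [set w | eps 1%N w != 0%N].
    by apply: (measurable_saturated (fun m => meps m (ltn0Sn 0))) => w w' /= ->.
  rewrite /q (_ : (fun w => _) = \1_[set w | eps 1%N w != 0%N]); last first.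
    by apply/funext => w; rewrite indicE mem_setE.
  rewrite /Rintegral integral_indic// setIT fine_gt0// eps_neq0/=.
  by rewrite ltey_eq fin_num_measure.
exists (Num.min q (Num.min alpha (1 - alpha))).
  by rewrite !lt_min q0 a0 subr_gt0 a1.
move=> k [|x].
  rewrite ge_min; apply/orP; left; rewrite /change_prob /Rintegral.
  under eq_integral => w _ do rewrite /S inar_sum0.
  by rewrite (@eps_integral k.+1 (fun y => (y != 0%N)%:R)).
rewrite ge_min; apply/orP; right.
set c := Num.min _ _; have c0 : 0 <= c by rewrite le_min !ltW ?subr_gt0.
have [P1 P0] := xi_bern (ltn0Sn k) (ltn0Sn x).
pose E v := xi k.+1 x.+1 @^-1` [set v].
have mE v : measurable (E v) by exact: mxi.
have IE v y : \int[P]_(w in E v) (S k.+1 x w != y)%:R =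
    fine (P (E v)) * \int[P]_w (S k.+1 x w != y)%:R.
  apply: (@Rintegral_independent _ _ _ P (S k.+1 x) (E v) (fun z => (z != y)%:R)) => //.
  - by move=> z; exact: mS.
  - by move=> z; exact: xi_inar_sum_independent.
have split01 : c <= \int[P]_(w in E 0%N) (S k.+1 x w != x.+1)%:R +
    \int[P]_(w in E 1%N) (S k.+1 x w != x)%:R.
  rewrite !IE [P (E 0%N)]P0 [P (E 1%N)]P1 /=.
  have J0 y : 0 <= \int[P]_w (S k.+1 x w != y)%:R :> R by exact: Rintegral_ge0.
  apply: (@le_trans _ _ (c * (\int[P]_w (S k.+1 x w != x.+1)%:R +
      \int[P]_w (S k.+1 x w != x)%:R))); last first.
    by rewrite mulrDr lerD// ler_wpM2r// /c ge_min lexx ?orbT.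
  rewrite ler_peMr// -RintegralD// -[leLHS]cst_integral; apply: le_Rintegral => //.
  - exact: finite_measure_integrable_cst.
  - by apply: eq_integrable (integrableD measurableT (neq_int k x x.+1) (neq_int k x x)).
  - move=> w _; have [->|_] := eqVneq (S k.+1 x w) x; last by rewrite lerDr.
    by rewrite addr0 (_ : (_ != _) = true)// neq_ltn ltnSn.
apply: (le_trans split01).
have -> : \int[P]_(w in E 0%N) (S k.+1 x w != x.+1)%:R =
    \int[P]_(w in E 0%N) (S k.+1 x.+1 w != x.+1)%:R :> R.
  by apply: eq_Rintegral => w; rewrite inE /E /= /S inar_sumS => ->.
have -> : \int[P]_(w in E 1%N) (S k.+1 x w != x)%:R =
    \int[P]_(w in E 1%N) (S k.+1 x.+1 w != x.+1)%:R :> R.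
  by apply: eq_Rintegral => w; rewrite inE /E /= /S inar_sumS => ->.
have iE := integrableS measurableT (measurableU _ _ (mE 0%N) (mE 1%N))
  (@subsetT _ _) (neq_int k x.+1 x.+1).
rewrite -Rintegral_setU//; last first.
  by apply/disj_setPS => w []; rewrite /E /= => ->.
rewrite /change_prob /Rintegral fine_le//.
- by apply: integrable_fin_num iE; exact: measurableU.
- exact: integrable_fin_num (neq_int k x.+1 x.+1).
- apply: ge0_subset_integral => //; first exact: measurableU.
  exact: measurable_int (neq_int k x.+1 x.+1).
Qed.

(** The change indicators minus their conditional probabilities are bounded martingale differences.
    Their mean is eventually within p / 2 of zero, while the conditional probabilities are at least
    p. *)
Lemma inar_change_frequency : exists2 p : R, 0 < p & {ae P, forall w,
  \forall n \near \oo, p * n%:R <= \sum_(i < n) (X i.+1 w != X i w)%:R}.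
Proof.
have [p p0 ph] := inar_change_prob_lb.
have h1 k x : 0 <= change_prob k x <= 1.
  apply/andP; split; first exact: Rintegral_ge0.
  rewrite -[leRHS]cst_integral; apply: le_Rintegral => //.
    exact: finite_measure_integrable_cst.
  by move=> w _; rewrite lern1 leq_b1.
pose V k w : R := (X k.+1 w != X k w)%:R - change_prob k (X k w).
have Vs k w w' : path k.+1 w = path k.+1 w' -> V k w = V k w'.
  move=> pw; rewrite /V /X (inar_path_state pw).
  by rewrite (inar_path_state (inar_path_le pw)).
have mV k : measurable_fun setT (V k).
  by apply: (measurable_fun_saturated (m_path k.+1)) => w w'; exact: Vs.
have V1 k w : V k w ^+ 2 <= 1.
  rewrite /V; have /andP[] := h1 k (X k w).
  move: (change_prob k _) => h h0 h_1; case: (_ != _); rewrite ?mulr1n ?mulr0n.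
    by rewrite expr2 mulr_ile1 ?subr_ge0// gerBl.
  by rewrite sub0r sqrrN expr2 mulr_ile1.
have V2 k : square_integrable P (V k).
  apply: (square_integrable_le (mV k) _ (square_integrable_cst P 1)) => w /=.
  by rewrite expr1n.
have mdV : md V.
  split => // k q; set x := head 0%N q.
  rewrite [LHS](Rintegral_inar_path mX0 meps mxi indep
    (phi := fun x y => (y != x)%:R - change_prob k x)).
    by rewrite [X in _ * X]Rintegral_sub_cst ?subrr ?mulr0.
  exact: square_integrable_integrable
    (square_integrableB (neq_L2 k x x) (square_integrable_cst P _)).
have LLN := strong_law m_path p_le (V := V) (Vt := fun=> V) (C := 1) Vs (fun=> mdV).
exists (p / 2); first by rewrite divr_gt0.
have {LLN}: {ae P, forall w, (\sum_(i < n) V i w) / n%:R @[n --> \oo] --> (0 : R)}.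
  apply: LLN.
    move=> m i; rewrite mul1r; apply: (@le_trans _ _ 1); last first.
      by rewrite exprn_ege1// ler1n.
    rewrite -[leRHS]cst_integral; apply: le_Rintegral => //; first exact: (V2 i).2.
    exact: finite_measure_integrable_cst.
  move=> m; rewrite (_ : [set w | _] = set0) ?measure0.
    by rewrite lee_fin mul1r exprn_ge0//; lra.
  by apply/seteqP; split => // w [k _]; rewrite eqxx.
apply: filterS => w /cvgrPdist_lt /(_ (p / 2)); rewrite divr_gt0// => /(_ isT).
apply: filterS2 (nbhs_infty_gt 0) => n n0; rewrite sub0r normrN.
rewrite normrM normfV normr_nat ltr_pdivrMr ?ltr0n// ltr_norml => /andP[+ _].
rewrite /V sumrB ltrBrDr => /ltW.
have : p * n%:R <= \sum_(i < n) change_prob i (X i w).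
  rewrite mulr_natr -[n in leLHS]card_ord -sumr_const.
  by apply: ler_sum => i _; exact: ph.
lra.
Qed.

End inar_moments.

(** * The least-squares criterion with outliers *)

Section profile.
Context {R : realType}.
Variables (s : nat) (y : nat -> R).

Let regular (k : nat) := k \notin [:: s; s.+1; s.+2].

Definition regular_sum (n : nat) (g : nat -> R) : R :=
  \sum_(1 <= k < n.+1 | regular k) g k.

Definition regular_sqr n a m := regular_sum n (fun k => (y k - a * y k.-1 - m) ^+ 2).

Definition outlier_den (a : R) := 1 + a ^+ 2 + a ^+ 4.

Definition outlier_num (a m : R) :=
  y s.+2 - a ^+ 3 * y s.-1 - (1 + a + a ^+ 2) * m.

Definition outlier_cost a m := outlier_num a m ^+ 2 / outlier_den a.

Definition profile n a m := regular_sqr n a m + outlier_cost a m.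

(** [theta1] and [theta2] make the three exceptional residuals equal to (a^2, a, 1) times
    [outlier_num a m / outlier_den a], the part no choice of outlier parameters can remove. *)
Definition theta1 a m :=
  y s - a * y s.-1 - m - a ^+ 2 * (outlier_num a m / outlier_den a).

Definition theta2 a m :=
  y s.+1 - a * y s - m + a * theta1 a m - a * (outlier_num a m / outlier_den a).

Lemma outlier_den_ge1 a : 1 <= outlier_den a.
Proof.
rewrite /outlier_den -addrA lerDl addr_ge0 ?sqr_ge0//.
by rewrite (exprM a 2 2) sqr_ge0.
Qed.

Lemma outlier_den_gt0 a : 0 < outlier_den a.
Proof. exact: lt_le_trans (outlier_den_ge1 a). Qed.

Lemma outlier_cost_ge0 a m : 0 <= outlier_cost a m.
Proof. by rewrite divr_ge0 ?sqr_ge0// ltW// outlier_den_gt0. Qed.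

(* Lagrange's identity for the residual vector and its component along
(a^2, a, 1), the direction orthogonal to the span of the outlier columns. *)
Lemma Qn_profile n a m t1 t2 :
  let p := y s - a * y s.-1 - m - t1 in
  let q := y s.+1 - a * y s - m + a * t1 - t2 in
  let r := y s.+2 - a * y s.+1 - m + a * t2 in
  Qn s n y a m t1 t2 = profile n a m +
    ((a * p - a ^+ 2 * q) ^+ 2 + (p - a ^+ 2 * r) ^+ 2 + (q - a * r) ^+ 2) /
      outlier_den a.
Proof.
move=> p q r; rewrite /Qn /profile /regular_sqr /regular_sum -/p -/q -/r.
rewrite -!addrA; congr (_ + _); rewrite /outlier_cost -mulrDl.
have d0 := lt0r_neq0 (outlier_den_gt0 a).
apply: (mulIf d0); rewrite mulfVK// /outlier_num /outlier_den /p /q /r.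
ring.
Qed.

Lemma profile_le_Qn n a m t1 t2 : profile n a m <= Qn s n y a m t1 t2.
Proof.
rewrite Qn_profile lerDl; apply: divr_ge0; last exact/ltW/outlier_den_gt0.
by rewrite !addr_ge0 ?sqr_ge0.
Qed.

(** The squares of Lagrange's identity vanish, so the residuals are a^2 r, a r, r. Pairing them with
    (a^2, a, 1) eliminates t1 and t2 and identifies r. *)
Lemma Qn_eq_profile n a m t1 t2 : Qn s n y a m t1 t2 <= profile n a m ->
  t1 = theta1 a m /\ t2 = theta2 a m.
Proof.
have d0 := outlier_den_gt0 a.
rewrite Qn_profile gerDl pmulr_lle0 ?invr_gt0//.
set p := y s - _ - _ - t1; set q := _ - t2; set r := _ + a * t2 => le0.
have [pr qr] : p = a ^+ 2 * r /\ q = a * r.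
  have h1 := sqr_ge0 (a * p - a ^+ 2 * q).
  have h2 := sqr_ge0 (p - a ^+ 2 * r).
  have h3 := sqr_ge0 (q - a * r).
  have e2 : (p - a ^+ 2 * r) ^+ 2 = 0 by lra.
  have e3 : (q - a * r) ^+ 2 = 0 by lra.
  by split; apply/eqP; rewrite -subr_eq0 -sqrf_eq0 ?e2 ?e3.
have rE : outlier_num a m / outlier_den a = r.
  apply: (mulIf (lt0r_neq0 d0)); rewrite mulfVK ?lt0r_neq0//.
  rewrite [RHS](_ : _ = a ^+ 2 * (a ^+ 2 * r) + a * (a * r) + r); last first.
    by rewrite /outlier_den; ring.
  by rewrite -pr -qr /outlier_num /p /q /r; ring.
have t1E : t1 = theta1 a m by rewrite /theta1 rE -pr /p; ring.
by split => //; rewrite /theta2 rE -t1E -qr /q; ring.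
Qed.

Lemma Qn_theta n a m :
  Qn s n y a m (theta1 a m) (theta2 a m) = profile n a m.
Proof.
have d0 := lt0r_neq0 (outlier_den_gt0 a).
set r := outlier_num a m / outlier_den a.
rewrite Qn_profile.
have -> : y s - a * y s.-1 - m - theta1 a m = a ^+ 2 * r.
  by rewrite /theta1 -/r; ring.
have -> : y s.+1 - a * y s - m + a * theta1 a m - theta2 a m = a * r.
  by rewrite /theta2 -/r; ring.
have -> : y s.+2 - a * y s.+1 - m + a * theta2 a m = r.
  rewrite /theta2 /theta1 -/r.
  suff : r * outlier_den a = outlier_num a m.
    by rewrite /outlier_den /outlier_num => h; apply/eqP; rewrite -subr_eq0; apply/eqP; move: h; lra.
  by rewrite /r mulfVK.
by rewrite [X in _ + X / _](_ : _ = 0) ?mul0r ?addr0//; ring.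
Qed.

Lemma unique_global_minimizer_Qn n a m :
  (forall a' m', profile n a m <= profile n a' m') ->
  (forall a' m', profile n a' m' <= profile n a m -> (a', m') = (a, m)) ->
  unique_global_minimizer (Qn s n y) a m (theta1 a m) (theta2 a m).
Proof.
move=> amin auniq; split.
  by move=> a' m' t1 t2; rewrite Qn_theta; apply: le_trans (profile_le_Qn _ _ _ _ _).
move=> a' m' t1 t2 tmin.
have [aa mm] : (a', m') = (a, m).
  by apply: auniq; rewrite -(Qn_theta n a m) (le_trans _ (tmin _ _ _ _))//; exact: profile_le_Qn.
rewrite {}aa {}mm in tmin *.
have [-> ->] // : t1 = theta1 a m /\ t2 = theta2 a m.
  by apply: (@Qn_eq_profile n); rewrite -(Qn_theta n a m); exact: tmin.
Qed.

(** Half the Hessian form of [regular_sqr], which is quadratic in (a, m), so the expansions below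
    are exact. *)
Definition design n u v := regular_sum n (fun k => (u * y k.-1 + v) ^+ 2).

Definition residual_sum n a m := regular_sum n (fun k => y k - a * y k.-1 - m).

Definition score_sum n a m :=
  regular_sum n (fun k => (y k - a * y k.-1 - m) * y k.-1).

Lemma regular_sqrD n a m u v : regular_sqr n (a + u) (m + v) =
  regular_sqr n a m - 2 * u * score_sum n a m - 2 * v * residual_sum n a m
  + design n u v.
Proof.
rewrite /regular_sqr /score_sum /residual_sum /design /regular_sum.
rewrite !mulr_sumr -!sumrN -!big_split /=.
by apply: eq_bigr => k _; ring.
Qed.

Lemma regular_sqr_midpoint n a m u v :
  regular_sqr n (a + u) (m + v) + regular_sqr n (a - u) (m - v) =
  2 * regular_sqr n a m + 2 * design n u v.
Proof.
have -> : design n u v = design n (- u) (- v).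
  by apply: eq_bigr => k _; ring.
rewrite !regular_sqrD (_ : design n (- u) (- v) = design n u v); last first.
  by apply: eq_bigr => k _; ring.
ring.
Qed.

(** Bounds [outlier_num] for |a| <= 2 and |m| <= M: there |a|^3 <= 8 and |1 + a + a^2| <= 7. *)
Definition outlier_num_bound (M : R) := `|y s.+2| + 8 * `|y s.-1| + 7 * M.

(** The bracket bounds the second difference of [outlier_num] and 52 = 2 + 48 + 2 that of
    [outlier_den], per unit of u^2 + v^2, when |a| <= 2 and |u| <= 1. *)
Definition outlier_curvature (M : R) :=
  2 * outlier_num_bound M * (12 * `|y s.-1| + 2 * M + 10) +
  52 * outlier_num_bound M ^+ 2.

(* x^2/d is convex in (x, d), being the supremum over l of 2 l x - l^2 d, so
only the polynomials outlier_num and outlier_den need a second-order bound. *)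
Lemma outlier_cost_midpoint a m u v (M : R) :
  `|a| <= 2 -> `|u| <= 1 -> `|m| <= M ->
  2 * outlier_cost a m - outlier_curvature M * (u ^+ 2 + v ^+ 2) <=
    outlier_cost (a + u) (m + v) + outlier_cost (a - u) (m - v).
Proof.
move=> a2 u1 mM; set C := outlier_curvature M.
pose Nb := outlier_num_bound M.
set l := outlier_num a m / outlier_den a.
have lower b k : 2 * l * outlier_num b k - l ^+ 2 * outlier_den b <= outlier_cost b k.
  have d0 := outlier_den_gt0 b.
  rewrite /outlier_cost -subr_ge0.
  rewrite (_ : _ - _ = (outlier_num b k - l * outlier_den b) ^+ 2 / outlier_den b).
    by rewrite divr_ge0 ?sqr_ge0// ltW.
  apply: (mulIf (lt0r_neq0 d0)); rewrite mulrBl !mulfVK ?lt0r_neq0//; ring.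
have at_mid : outlier_cost a m = 2 * l * outlier_num a m - l ^+ 2 * outlier_den a.
  have d0 := lt0r_neq0 (outlier_den_gt0 a).
  by rewrite /outlier_cost /l; field.
apply: le_trans (lerD (lower _ _) (lower _ _)); rewrite at_mid.
pose w := u ^+ 2 + v ^+ 2.
have M0 : 0 <= M by apply: le_trans mM.
pose y1 := `|y s.-1|.
have y10 : 0 <= y1 by exact: normr_ge0.
have a22 : a ^+ 2 <= 4.
  rewrite -(real_normK (num_real a)) (_ : 4 = 2 ^+ 2); last by ring.
  by rewrite lerXn2r ?nnegrE.
have Nb0 : 0 <= Nb by rewrite /Nb /outlier_num_bound !addr_ge0// mulr_ge0.
have NumB : `|outlier_num a m| <= Nb.
  have h1 : `|a ^+ 3 * y s.-1| <= 8 * `|y s.-1|.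
    rewrite normrM ler_wpM2r// normrX.
    by rewrite (_ : 8 = 2 ^+ 3); [rewrite lerXn2r ?nnegrE|ring].
  have h2 : `|(1 + a + a ^+ 2) * m| <= 7 * M.
    rewrite normrM ler_pM//.
    apply: le_trans (ler_normD _ _) _.
    rewrite [X in _ + X]ger0_norm ?sqr_ge0//.
    have := ler_normD 1 a; rewrite normr1; lra.
  rewrite /outlier_num /Nb /outlier_num_bound.
  apply: le_trans (ler_normB _ _) _; rewrite lerD//.
  by apply: le_trans (ler_normB _ _) _; rewrite lerD2l.
have lB : `|l| <= Nb.
  rewrite /l normrM normfV (gtr0_norm (outlier_den_gt0 a)).
  rewrite ler_pdivrMr ?outlier_den_gt0//; apply: (le_trans NumB).
  by rewrite ler_peMr// outlier_den_ge1.
(* [dN] and [dD] are the symmetric second differences of numerator and denominator. *)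
pose dN := - 6 * a * u ^+ 2 * y s.-1 - (2 * u ^+ 2 * m + 2 * u * v * (1 + 2 * a)).
pose dD := 2 * u ^+ 2 + 12 * a ^+ 2 * u ^+ 2 + 2 * u ^+ 4.
have u2w : u ^+ 2 <= w by rewrite lerDl sqr_ge0.
have w0 : 0 <= w by rewrite addr_ge0 ?sqr_ge0.
have dN_bound : `|dN| <= (12 * y1 + 2 * M + 10) * w.
  have n1 : `|- 6 * a * u ^+ 2 * y s.-1| <= 12 * y1 * w.
    move: (u ^+ 2) (sqr_ge0 u) u2w => U U0 Uw.
    rewrite !normrM normrN normr_nat (ger0_norm U0) -/y1.
    rewrite mulrAC ler_pM ?mulr_ge0//.
    by rewrite ler_wpM2r// (_ : 12 = 6 * 2); [rewrite ler_wpM2l|ring].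
  have n2 : `|2 * u ^+ 2 * m| <= 2 * M * w.
    move: (u ^+ 2) (sqr_ge0 u) u2w => U U0 Uw.
    rewrite !normrM normr_nat (ger0_norm U0) mulrAC.
    by rewrite ler_pM ?mulr_ge0// ler_wpM2l.
  have n3 : `|2 * u * v * (1 + 2 * a)| <= 10 * w.
    have uv : `|2 * u * v| <= 2 * w.
      rewrite ler_norml /w; have := sqr_ge0 (u + v); have := sqr_ge0 (u - v).
      have := sqr_ge0 u; have := sqr_ge0 v.
      move=> ? ? ? ?; apply/andP; split; lra.
    rewrite normrM (_ : 10 * w = 2 * w * 5); last by ring.
    rewrite ler_pM//; apply: le_trans (ler_normD _ _) _.
    rewrite normr1 normrM normr_nat; lra.
  apply: le_trans (ler_normB _ _) _.
  rewrite [leRHS](_ : _ = 12 * y1 * w + (2 * M * w + 10 * w)); last by ring.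
  by rewrite lerD// (le_trans (ler_normD _ _))// lerD.
have dD_bound : 0 <= dD <= 52 * w.
  have u21 : u ^+ 2 <= 1 by rewrite -(real_normK (num_real u)) expr_le1.
  have u4 : u ^+ 4 = u ^+ 2 * u ^+ 2 by ring.
  rewrite /dD u4; have := sqr_ge0 u; have := sqr_ge0 a => ? ?.
  have au0 : 0 <= a ^+ 2 * u ^+ 2 by rewrite mulr_ge0.
  have uu0 : 0 <= u ^+ 2 * u ^+ 2 by rewrite mulr_ge0.
  apply/andP; split; first by lra.
  have : a ^+ 2 * u ^+ 2 <= 4 * u ^+ 2 by rewrite ler_wpM2r.
  have : u ^+ 2 * u ^+ 2 <= u ^+ 2 by rewrite ler_piMr.
  lra.
suff : - (C * w) <= 2 * l * dN - l ^+ 2 * dD.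
  rewrite -/w /dN /dD /outlier_num /outlier_den; lra.
have h1 : `|2 * l * dN| <= 2 * Nb * ((12 * y1 + 2 * M + 10) * w).
  rewrite normrM; apply: ler_pM => //.
  by rewrite normrM normr_nat ler_wpM2l.
have h2 : l ^+ 2 * dD <= Nb ^+ 2 * (52 * w).
  case/andP: dD_bound => ? ?; apply: ler_pM => //; first exact: sqr_ge0.
  by rewrite -(real_normK (num_real l)) lerXn2r ?nnegrE.
move: h1; rewrite ler_norml => /andP[h1 _].
rewrite /C /outlier_curvature -/y1 -/Nb; lra.
Qed.

(** With w = u^2 + v^2, the quadratic term gains C w, each of the two linear terms loses at most C w
    / 4, and the outlier cost at the centre is below C w / 2. *)
Lemma profile_far n a m C b r u v : 0 < r -> 0 <= C ->
  C * (u ^+ 2 + v ^+ 2) <= design n u v ->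
  `|score_sum n a m| <= b -> `|residual_sum n a m| <= b ->
  8 * b <= r * C -> 2 * outlier_cost a m < C * r ^+ 2 ->
  r ^+ 2 <= u ^+ 2 + v ^+ 2 -> profile n a m < profile n (a + u) (m + v).
Proof.
move=> r0 C0 dC sb eb bC GC rw.
rewrite /profile regular_sqrD.
have b0 : 0 <= b by apply: le_trans sb.
set w := u ^+ 2 + v ^+ 2 in dC rw *.
have w0 : 0 <= w by rewrite addr_ge0 ?sqr_ge0.
have lin x : x ^+ 2 <= w -> `|x| * r <= w.
  move=> xw; rewrite -(real_normK (num_real x)) in xw.
  have := sqr_ge0 (`|x| - r); nra.
have uw := lin u (_ : u ^+ 2 <= w); have vw := lin v (_ : v ^+ 2 <= w).
have {}uw : `|u| * r <= w by apply: uw; rewrite lerDl sqr_ge0.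
have {}vw : `|v| * r <= w by apply: vw; rewrite lerDr sqr_ge0.
have term x s' : `|x| * r <= w -> `|s'| <= b -> 2 * x * s' <= C * w / 4.
  move=> xw s'b.
  have h1 : 2 * x * s' <= 2 * (`|x| * b).
    rewrite -mulrA ler_pM2l//; apply: le_trans (ler_norm _) _.
    by rewrite normrM ler_wpM2l.
  have h2 : 8 * b * `|x| <= r * C * `|x| by rewrite ler_wpM2r.
  have h3 : C * (`|x| * r) <= C * w by rewrite ler_wpM2l.
  lra.
have t1 := term _ _ uw sb; have t2 := term _ _ vw eb.
have h4 : C * r ^+ 2 <= C * w by rewrite ler_wpM2l.
have := outlier_cost_ge0 (a + u) (m + v); lra.
Qed.

Let cvgXn (U : Type) (F : set_system U) (FF : Filter F) (f : U -> R) (l : R) n :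
  f x @[x --> F] --> l -> f x ^+ n @[x --> F] --> l ^+ n.
Proof.
move=> fl; exact: (@cvg_comp _ _ _ f (fun x : R => x ^+ n) F _ _ fl
  (@exprn_continuous R n l)).
Qed.

Lemma cvg_outlier_num (U : Type) (F : set_system U) (FF : Filter F)
    (fa fm : U -> R) (a m : R) :
  fa x @[x --> F] --> a -> fm x @[x --> F] --> m ->
  outlier_num (fa x) (fm x) @[x --> F] --> outlier_num a m.
Proof.
move=> ca cm; rewrite /outlier_num.
apply: cvgB; first by apply: cvgB; [exact: cvg_cst|apply: cvgM; [exact: cvgXn|exact: cvg_cst]].
apply: cvgM => //; apply: cvgD; last exact: cvgXn.
by apply: cvgD => //; exact: cvg_cst.
Qed.

Lemma cvg_outlier_denV (U : Type) (F : set_system U) (FF : Filter F)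
    (fa : U -> R) (a : R) : fa x @[x --> F] --> a ->
  (outlier_den (fa x))^-1 @[x --> F] --> (outlier_den a)^-1.
Proof.
move=> ca; apply: cvgV; first by rewrite gt_eqF// outlier_den_gt0.
apply: cvgD; last exact: cvgXn.
by apply: cvgD; [exact: cvg_cst|exact: cvgXn].
Qed.

Lemma cvg_theta1 (U : Type) (F : set_system U) (FF : Filter F)
    (fa fm : U -> R) (a m : R) :
  fa x @[x --> F] --> a -> fm x @[x --> F] --> m ->
  theta1 (fa x) (fm x) @[x --> F] --> theta1 a m.
Proof.
move=> ca cm; rewrite /theta1; apply: cvgB.
  apply: cvgB => //; apply: cvgB; first exact: cvg_cst.
  by apply: cvgM => //; exact: cvg_cst.
apply: cvgM; first exact: cvgXn.
by apply: cvgM; [exact: cvg_outlier_num|exact: cvg_outlier_denV].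
Qed.

Lemma cvg_theta2 (U : Type) (F : set_system U) (FF : Filter F)
    (fa fm : U -> R) (a m : R) :
  fa x @[x --> F] --> a -> fm x @[x --> F] --> m ->
  theta2 (fa x) (fm x) @[x --> F] --> theta2 a m.
Proof.
move=> ca cm; rewrite /theta2; apply: cvgB; last first.
  by apply: cvgM => //; apply: cvgM; [exact: cvg_outlier_num|exact: cvg_outlier_denV].
apply: cvgD; last by apply: cvgM => //; exact: cvg_theta1.
apply: cvgB => //; apply: cvgB; first exact: cvg_cst.
by apply: cvgM => //; exact: cvg_cst.
Qed.

Lemma continuous_profile n :
  continuous (fun z : R * R => profile n z.1 z.2).
Proof.
move=> z; rewrite /profile /regular_sqr /regular_sum.
have c1 : (x.1 : R) @[x --> z] --> z.1 by exact: cvg_fst.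
have c2 : (x.2 : R) @[x --> z] --> z.2 by exact: cvg_snd.
apply: cvgD.
  apply: (@cvg_big _ _ +%R) => [|k _]; first exact: add_continuous.
  apply: cvgXn; apply: cvgB => //; apply: cvgB; first exact: cvg_cst.
  by apply: cvgM => //; exact: cvg_cst.
apply: cvgM; last exact: cvg_outlier_denV.
by apply: cvgXn; exact: cvg_outlier_num.
Qed.

(** Existence is by compactness of a square around (a, m), outside which the profile exceeds its
    central value. For uniqueness, two minimisers are compared with their midpoint; r <= 1 keeps it
    in the range of the curvature bound. *)
Lemma profile_minimizer n a m C r : 0 < r <= 1 -> `|a| <= 1 ->
  (forall u v, r ^+ 2 <= u ^+ 2 + v ^+ 2 ->
    profile n a m < profile n (a + u) (m + v)) ->
  (forall u v, C * (u ^+ 2 + v ^+ 2) <= design n u v) ->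
  outlier_curvature (`|m| + 1) < 2 * C ->
  exists a' m', [/\ `|a' - a| <= r, `|m' - m| <= r,
    forall a'' m'', profile n a' m' <= profile n a'' m'' &
    forall a'' m'', profile n a'' m'' <= profile n a' m' -> (a'', m'') = (a', m')].
Proof.
move=> /andP[r0 r1] a1 far dC curv.
have far' a' m' : profile n a' m' <= profile n a m ->
    `|a' - a| <= r /\ `|m' - m| <= r.
  move=> le'.
  have [//|w] := ltP ((a' - a) ^+ 2 + (m' - m) ^+ 2) (r ^+ 2); last first.
    have := far _ _ w; rewrite !subrKC => /lt_le_trans /(_ le').
    by rewrite ltxx.
  move=> w; split; rewrite leNgt; apply/negP => rx; move: w; apply/negP;
    rewrite -leNgt.
    apply: (@le_trans _ _ ((a' - a) ^+ 2)); last by rewrite lerDl sqr_ge0.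
    by rewrite -(real_normK (num_real (_ - _))) lerXn2r ?nnegrE// ltW.
  apply: (@le_trans _ _ ((m' - m) ^+ 2)); last by rewrite lerDr sqr_ge0.
  by rewrite -(real_normK (num_real (_ - _))) lerXn2r ?nnegrE// ltW.
pose A := `[a - r, a + r]%classic `*` `[m - r, m + r]%classic : set (R * R).
have inA a' m' : `|a' - a| <= r -> `|m' - m| <= r -> A (a', m').
  by rewrite !ler_distl /A /= !in_itv /= => -> ->.
have A0 : A !=set0.
  by exists (a, m); apply: inA; rewrite subrr normr0 ltW.
have cA : compact A by apply: compact_setX; exact: segment_compact.
have [[a' m'] _ minA] := compact_EVT_min A0 cA
  (continuous_subspaceT (@continuous_profile n)).
have min' a'' m'' : profile n a' m' <= profile n a'' m''.
  have amA : profile n a' m' <= profile n a m.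
    by apply: (minA (a, m)); rewrite inE; apply: inA; rewrite subrr normr0 ltW.
  have [le|/ltW] := leP (profile n a'' m'') (profile n a m); last exact: le_trans.
  have [? ?] := far' _ _ le.
  by apply: (minA (a'', m'')); rewrite inE; exact: inA.
have [ar mr] := far' _ _ (min' a m).
exists a', m'; split => // a2 m2 le2.
have [ar2 mr2] := far' _ _ (le_trans le2 (min' a m)).
pose ac := (a' + a2) / 2; pose mc := (m' + m2) / 2.
pose u := (a' - a2) / 2; pose v := (m' - m2) / 2.
have := @outlier_cost_midpoint ac mc u v (`|m| + 1).
have := regular_sqr_midpoint n ac mc u v.
have -> : ac + u = a' by rewrite /ac /u; field.
have -> : ac - u = a2 by rewrite /ac /u; field.
have -> : mc + v = m' by rewrite /mc /v; field.
have -> : mc - v = m2 by rewrite /mc /v; field.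
move=> reg out.
move: ar mr ar2 mr2; rewrite !ler_distl => /andP[? ?] /andP[? ?] /andP[? ?] /andP[? ?].
move: (a1); rewrite ler_norml => /andP[? ?].
have {}out := out _ _ _.
have {out} : 2 * outlier_cost ac mc - outlier_curvature (`|m| + 1) * (u ^+ 2 + v ^+ 2) <=
    outlier_cost a' m' + outlier_cost a2 m2.
  apply: out; rewrite /ac /mc /u ler_norml.
  - by apply/andP; split; lra.
  - by apply/andP; split; lra.
  - have h1 := ler_norm m; have := ler_norm (- m); rewrite normrN => h2.
    by apply/andP; split; lra.
have mid := min' ac mc; have mid2 := min' a2 m2.
have dd := dC u v.
set w := u ^+ 2 + v ^+ 2 in dd *.
have w0 : 0 <= w by rewrite addr_ge0 ?sqr_ge0.
move: mid mid2 le2; rewrite /profile => mid mid2 le2 out.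
(* The midpoint inequalities give (2 C - curvature) w <= 0. *)
have w_eq0 : w = 0 by nra.
have u0 : u = 0.
  apply/eqP; rewrite -sqrf_eq0; apply/eqP/le_anti.
  by rewrite sqr_ge0 andbT -w_eq0 lerDl sqr_ge0.
have v0 : v = 0.
  apply/eqP; rewrite -sqrf_eq0; apply/eqP/le_anti.
  by rewrite sqr_ge0 andbT -w_eq0 lerDr sqr_ge0.
by congr pair; [move: u0; rewrite /u|move: v0; rewrite /v]; lra.
Qed.

Lemma profile_minimizer_cvg (a m c : R) : `|a| <= 1 -> 0 < c ->
  (\forall n \near \oo, forall u v,
    c * n%:R * (u ^+ 2 + v ^+ 2) <= design n u v) ->
  score_sum n a m / n%:R @[n --> \oo] --> (0 : R) ->
  residual_sum n a m / n%:R @[n --> \oo] --> (0 : R) ->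
  exists (n0 : nat) (ha hm : nat -> R),
    [/\ forall n, (n0 <= n)%N -> unique_global_minimizer (Qn s n y)
          (ha n) (hm n) (theta1 (ha n) (hm n)) (theta2 (ha n) (hm n)),
        ha @ \oo --> a & hm @ \oo --> m].
Proof.
move=> a1 c0 Hd Hs He.
pose uniq_min n a' m' :=
  (forall a'' m'', profile n a' m' <= profile n a'' m'') /\
  (forall a'' m'', profile n a'' m'' <= profile n a' m' -> (a'', m'') = (a', m')).
have near_min r : 0 < r <= 1 -> \forall n \near \oo,
    exists a' m', [/\ `|a' - a| <= r, `|m' - m| <= r & uniq_min n a' m'].
  move=> /andP[r0 r1].
  (* Chosen so that b = r (c n) / 8 meets the condition 8 b <= r C of [profile_far] with C = c n. *)
  have e0 : 0 < r * c / 8 by rewrite divr_gt0// mulr_gt0.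
  move/cvgrPdist_lt: (Hs) => /(_ _ e0) Hs'; move/cvgrPdist_lt: (He) => /(_ _ e0) He'.
  have Hbig (B : R) : \forall n \near \oo, B < c * n%:R.
    have [N BN] : exists N : nat, B / c < N%:R.
      exists (Num.bound `|B / c|).
      exact: le_lt_trans (ler_norm _) (archi_boundP (normr_ge0 _)).
    exists N => // n /= Nn; rewrite mulrC -ltr_pdivrMr//.
    by apply: lt_le_trans BN _; rewrite ler_nat.
  near=> n.
  have n0 : (0 : R) < n%:R by rewrite ltr0n; near: n; exact: nbhs_infty_gt.
  have small (x : R) : `|0 - x / n%:R| < r * c / 8 -> `|x| <= r * (c * n%:R) / 8.
    rewrite sub0r normrN normrM normfV normr_nat ltr_pdivrMr// => /ltW.
    by rewrite (_ : r * c / 8 * n%:R = r * (c * n%:R) / 8)//; ring.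
  have Hn : forall u v, c * n%:R * (u ^+ 2 + v ^+ 2) <= design n u v by near: n.
  have [|||a' [m' [? ? ? ?]]] := @profile_minimizer n a m (c * n%:R) r _ a1 _ Hn.
  - by rewrite r0.
  - move=> u v; apply: (@profile_far n a m (c * n%:R) (r * (c * n%:R) / 8) r) => //.
    + by rewrite mulr_ge0 ?ltW.
    + by apply: small; near: n.
    + by apply: small; near: n.
    + by rewrite mulrC mulfVK.
    + rewrite -ltr_pdivrMr ?exprn_gt0//; near: n; exact: Hbig.
  - rewrite mulrC -ltr_pdivrMr//; near: n; exact: Hbig.
  - by exists a', m'.
have [n0 _ Hn0] := near_min 1 ltac:(by rewrite ltr01 lexx).
have : forall n, exists z : R * R, (n0 <= n)%N -> uniq_min n z.1 z.2.
  move=> n; have [/Hn0 [a' [m' [_ _ ?]]]|] := leqP n0 n; first by exists (a', m').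
  by exists (0, 0).
move=> /choice[z Hz]; exists n0, (fun n => (z n).1), (fun n => (z n).2).
(* By uniqueness, the minimiser selected once for each n is the one found within r, whatever r
   is. *)
have close r : 0 < r <= 1 ->
    \forall n \near \oo, `|(z n).1 - a| <= r /\ `|(z n).2 - m| <= r.
  move=> r01; near=> n.
  have n0n : (n0 <= n)%N by near: n; exact: nbhs_infty_ge.
  have [a' [m' [ar mr [min' _]]]] : exists a' m',
    [/\ `|a' - a| <= r, `|m' - m| <= r & uniq_min n a' m'] by near: n; exact: near_min.
  have [_ /(_ a' m' (min' _ _))] := Hz n n0n.
  by case=> <- <-.
have min01 (e : R) : 0 < e -> 0 < Num.min (e / 2) 1 <= 1 /\ Num.min (e / 2) 1 < e.
  move=> e0; rewrite lt_min ltr01 divr_gt0// ge_min lexx orbT; split => //.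
  by rewrite gt_min; apply/orP; left; lra.
split.
- by move=> n n0n; have [? ?] := Hz n n0n; exact: unique_global_minimizer_Qn.
- apply/cvgrPdist_lt => e /min01[r01 re]; near=> n.
  rewrite distrC; apply: le_lt_trans re.
  have [+ _] : `|(z n).1 - a| <= Num.min (e / 2) 1 /\
      `|(z n).2 - m| <= Num.min (e / 2) 1 by near: n; exact: close.
  exact.
- apply/cvgrPdist_lt => e /min01[r01 re]; near=> n.
  rewrite distrC; apply: le_lt_trans re.
  have [_ +] : `|(z n).1 - a| <= Num.min (e / 2) 1 /\
      `|(z n).2 - m| <= Num.min (e / 2) 1 by near: n; exact: close.
  exact.
Unshelve. all: by end_near. Qed.

End profile.

(** * Means over the regular indices and growth of the design matrix *)

Section regular_sum_asymptotics.
Context {R : realType}.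

Lemma regular_sumE (s n : nat) (g : nat -> R) : (0 < s)%N -> (s.+2 <= n)%N ->
  regular_sum s n g = \sum_(i < n) g i.+1 - (g s + g s.+1 + g s.+2).
Proof.
move=> s0 sn; rewrite /regular_sum.
have -> : \sum_(i < n) g i.+1 = \sum_(1 <= k < n.+1) g k.
  by rewrite big_add1 /= big_mkord.
rewrite [in RHS](bigID (fun k => k \notin [:: s; s.+1; s.+2])) /=.
suff -> : \sum_(1 <= k < n.+1 | ~~ (k \notin [:: s; s.+1; s.+2])) g k =
    g s + g s.+1 + g s.+2 by rewrite addrK.
rewrite -big_filter (perm_big [:: s; s.+1; s.+2]).
  by rewrite 3!big_cons big_nil/= Monoid.mulm1 addrA.
apply: uniq_perm.
- by rewrite filter_uniq// iota_uniq.
- by rewrite /= !inE; lia.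
- move=> k; rewrite mem_filter negbK mem_index_iota andbC.
  apply/andP/idP => [[]//|ks]; split => //.
  by move: ks; rewrite !inE => /or3P[] /eqP ->; lia.
Qed.

Lemma eq_regular_sum (s n : nat) (g g' : nat -> R) :
  (forall k, (0 < k)%N -> k \notin [:: s; s.+1; s.+2] -> g k = g' k) ->
  regular_sum s n g = regular_sum s n g'.
Proof.
move=> gg; rewrite /regular_sum big_nat_cond [RHS]big_nat_cond.
by apply: eq_bigr => k /andP[/andP[k0 _] ks]; exact: gg.
Qed.

Lemma cvg_regular_mean (s : nat) (g : nat -> R) : (0 < s)%N ->
  (\sum_(i < n) g i.+1) / n%:R @[n --> \oo] --> (0 : R) ->
  regular_sum s n g / n%:R @[n --> \oo] --> (0 : R).
Proof.
move=> s0 gn; set K := g s + g s.+1 + g s.+2.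
have cK : (\sum_(i < n) g i.+1) / n%:R - K * (n%:R)^-1 @[n --> \oo] --> (0 : R).
  rewrite -[X in _ --> X](subr0 0); apply: cvgB => //.
  rewrite -[X in _ --> X](mulr0 K); apply: cvgMr; apply/gtr0_cvgV0.
    by near=> n; rewrite ltr0n; near: n; exact: nbhs_infty_gt.
  exact: cvgr_idn.
apply: cvg_trans cK; apply: near_eq_cvg; near=> n.
rewrite regular_sumE// ?mulrBl//.
by near: n; exact: nbhs_infty_ge.
Unshelve. all: by end_near. Qed.

(** Differences of consecutive affine values u x_i + v control u^2, since [x] moves often enough.
    Their mean controls u m + v with m the empirical mean, and boundedness of m then recovers
    v^2. *)
Lemma design_lower_bound (x d : nat -> R) (p M : R) : 0 < p -> 0 <= M ->
  (forall i, d i <= (x i.+1 - x i) ^+ 2) ->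
  (\forall n \near \oo, p * n%:R <= \sum_(i < n) d i) ->
  (\forall n \near \oo, `|\sum_(i < n) x i| <= M * n%:R) ->
  exists2 c : R, 0 < c & \forall n \near \oo, forall u v : R,
    c * n%:R * (u ^+ 2 + v ^+ 2) <= \sum_(i < n) (u * x i + v) ^+ 2.
Proof.
move=> p0 M0 dx [N1 _ HN1] [N2 _ HN2].
pose K := 2 + (1 + 2 * M ^+ 2) * (8 / p).
have H0 : 0 <= 1 + 2 * M ^+ 2 by rewrite addr_ge0// mulr_ge0// sqr_ge0.
have K0 : 0 < K by rewrite ltr_pwDl// mulr_ge0// divr_ge0// ltW.
exists K^-1; first by rewrite invr_gt0.
(* Among n values there are n - 1 increments; the shift by two gives n - 1 >= N1 and n - 1 > 0, so
   that n <= 2 (n - 1). *)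
exists (maxn N1.+2 N2) => // n /=; rewrite geq_max => /andP[nN1 nN2] u v.
set H := \sum_(i < n) _.
have n0 : (0 : R) < n%:R by rewrite ltr0n; apply: leq_trans nN1.
have slope : p * n%:R * u ^+ 2 <= 8 * H.
  case: n nN1 {nN2 n0} @H => // n; rewrite ltnS => nN1 H.
  have [n_gt0 nN1'] : (0 < n)%N /\ (N1 <= n)%N by split; lia.
  have h1 : \sum_(i < n) d i * u ^+ 2 <=
      \sum_(i < n) (2 * (u * x i.+1 + v) ^+ 2 + 2 * (u * x i + v) ^+ 2).
    apply: ler_sum => i _; apply: (@le_trans _ _ ((x i.+1 - x i) ^+ 2 * u ^+ 2)).
      by rewrite ler_wpM2r ?sqr_ge0.
    have := sqr_ge0 ((u * x i.+1 + v) + (u * x i + v)); lra.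
  rewrite -mulr_suml big_split /= -!mulr_sumr in h1.
  have h2 : \sum_(i < n) (u * x i.+1 + v) ^+ 2 <= H.
    by rewrite /H big_ord_recl /= lerDr sqr_ge0.
  have h3 : \sum_(i < n) (u * x i + v) ^+ 2 <= H.
    by rewrite /H big_ord_recr /= lerDl sqr_ge0.
  have h4 : p * n%:R * u ^+ 2 <= (\sum_(i < n) d i) * u ^+ 2.
    by rewrite ler_wpM2r ?sqr_ge0//; exact: HN1.
  have h5 : p * n.+1%:R * u ^+ 2 <= 2 * (p * n%:R * u ^+ 2).
    rewrite mulrA ler_wpM2r ?sqr_ge0// mulrCA ler_pM2l// -natrM ler_nat; lia.
  lra.
set m := (\sum_(i < n) x i) / n%:R.
have mM : `|m| <= M.
  by rewrite normrM normfV normr_nat ler_pdivrMr//; exact: HN2.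
have level : n%:R * (u * m + v) ^+ 2 <= H.
  set t := u * m + v.
  (* Jensen's inequality through the tangent line of the square at t. *)
  have -> : n%:R * t ^+ 2 = \sum_(i < n) (2 * t * (u * x i + v) - t ^+ 2).
    rewrite sumrB sumr_const card_ord -mulr_sumr big_split /= -mulr_sumr sumr_const card_ord.
    have -> : \sum_(i < n) x i = m * n%:R by rewrite /m mulfVK ?gt_eqF.
    rewrite -[v *+ n]mulr_natr -[t ^+ 2 *+ n]mulr_natr /t; ring.
  apply: ler_sum => i _; have := sqr_ge0 ((u * x i + v) - t); lra.
have m2 : m ^+ 2 <= M ^+ 2 by rewrite -(real_normK (num_real m)) lerXn2r ?nnegrE.
rewrite mulrAC -mulrA -ler_pdivlMl ?invr_gt0// invrK.
have v2 : v ^+ 2 <= 2 * (u * m + v) ^+ 2 + 2 * (m ^+ 2 * u ^+ 2).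
  have := sqr_ge0 (u * m + v + u * m); lra.
have mu2 : m ^+ 2 * u ^+ 2 <= M ^+ 2 * u ^+ 2 by rewrite ler_wpM2r ?sqr_ge0.
have uv : u ^+ 2 + v ^+ 2 <= 2 * (u * m + v) ^+ 2 + (1 + 2 * M ^+ 2) * u ^+ 2 by lra.
have slope' : n%:R * u ^+ 2 <= 8 / p * H.
  by rewrite mulrAC ler_pdivlMr// mulrC mulrA.
have h6 : (u ^+ 2 + v ^+ 2) * n%:R <=
    (2 * (u * m + v) ^+ 2 + (1 + 2 * M ^+ 2) * u ^+ 2) * n%:R.
  by rewrite ler_wpM2r// ltW.
have h7 : (1 + 2 * M ^+ 2) * (n%:R * u ^+ 2) <= (1 + 2 * M ^+ 2) * (8 / p * H).
  by rewrite ler_wpM2l.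
rewrite /K; lra.
Qed.

End regular_sum_asymptotics.

Lemma mean_bound {R : realType} (x : nat -> R) (a m : R) :
  0 < a < 1 -> (forall i, 0 <= x i) ->
  (\sum_(i < n) (x i.+1 - (a * x i + m))) / n%:R @[n --> \oo] --> (0 : R) ->
  exists2 M : R, 0 <= M & \forall n \near \oo, `|\sum_(i < n) x i| <= M * n%:R.
Proof.
move=> /andP[a0 a1] x0 /cvgrPdist_lt/(_ 1 ltr01) near1.
have a1' : 0 < 1 - a by rewrite subr_gt0.
exists ((1 + `|m| + x 0%N) / (1 - a)).
  by apply: divr_ge0; [rewrite !addr_ge0|exact: ltW].
near=> n.
have n0 : (0 < n)%N by near: n; exact: nbhs_infty_gt.
have n1 : (1 : R) <= n%:R by rewrite ler1n.
rewrite ger0_norm ?sumr_ge0// mulrAC ler_pdivlMr//.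
have sum_res : \sum_(i < n) (x i.+1 - (a * x i + m)) =
    (\sum_(i < n) x i) * (1 - a) + x n - x 0%N - n%:R * m.
  rewrite sumrB big_split /= -mulr_sumr sumr_const card_ord -[m *+ n]mulr_natl.
  have : \sum_(i < n.+1) x i = \sum_(i < n.+1) x i by [].
  rewrite {1}big_ord_recl big_ord_recr /= => h; lra.
have : `|0 - (\sum_(i < n) (x i.+1 - (a * x i + m))) / n%:R| < 1 by near: n.
rewrite sub0r normrN normrM normfV normr_nat ltr_pdivrMr ?mul1r ?ltr0n//.
rewrite sum_res ltr_norml => /andP[_ ub].
have xn := x0 n; have mm : n%:R * m <= n%:R * `|m|.
  by rewrite ler_wpM2l ?ler_norm.
have xx : x 0%N <= x 0%N * n%:R by rewrite ler_peMr.
lra.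
Unshelve. all: by end_near. Qed.

Lemma sqr_affine_le {R : realType} (a u v : R) :
  (u * a + v) ^+ 2 <= (a ^+ 2 + 1) * (u ^+ 2 + v ^+ 2).
Proof. by rewrite -subr_ge0 (_ : _ - _ = (u - a * v) ^+ 2) ?sqr_ge0//; ring. Qed.

(** * The almost sure statement, assembled path by path *)

Unset Implicit Arguments.
Set Strict Implicit.

Theorem theorem3p7p1 (R : realType) (d : measure_display) (T : measurableType d)
  (P : probability T R) (X0 : T -> nat) (eps : nat -> T -> nat)
  (xi : nat -> nat -> T -> nat) (alpha : R) (s th1 th2 : nat) :
  0 < alpha < 1 ->
  (0 < s)%N -> (0 < th1)%N -> (0 < th2)%N ->
  (* measurability of all primitive variables *)
  (forall m, measurable (X0 @^-1` [set m])) ->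
  (forall k m, (0 < k)%N -> measurable (eps k @^-1` [set m])) ->
  (forall k j m, (0 < k)%N -> (0 < j)%N -> measurable (xi k j @^-1` [set m])) ->
  (* mutual independence of X0, (eps_k)_{k>=1}, (xi_{k,j})_{k,j>=1} *)
  mutually_independent P inar_valid (inar_rv X0 eps xi) ->
  (* eps_k identically distributed *)
  (forall k m, (0 < k)%N -> P (eps k @^-1` [set m]) = P (eps 1%N @^-1` [set m])) ->
  (* E eps_1^2 < oo and P(eps_1 <> 0) > 0 *)
  (\int[P]_w (((eps 1%N w)%:R : R) ^+ 2)%:E < +oo)%E ->
  (0 < P [set w | eps 1%N w != 0%N])%E ->
  (* xi_{k,j} Bernoulli(alpha) *)
  (forall k j, (0 < k)%N -> (0 < j)%N ->
     P [set w | xi k j w = 1%N] = alpha%:E /\ P [set w | xi k j w = 0%N] = (1 - alpha)%:E) ->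
  (* E X0^2 < oo *)
  (\int[P]_w (((X0 w)%:R : R) ^+ 2)%:E < +oo)%E ->
  let mu := fine (\int[P]_w ((eps 1%N w)%:R : R)%:E) in
  let Y := @inarY R T X0 eps xi s th1 th2 in
  {ae P, forall w,
    exists (n0 : nat) (ha hm ht1 ht2 : nat -> R),
      (forall n, (n0 <= n)%N ->
         unique_global_minimizer (Qn s n (fun k => Y k w)) (ha n) (hm n) (ht1 n) (ht2 n)) /\
      ha @ \oo --> alpha /\
      hm @ \oo --> mu /\
      ht1 @ \oo --> (Y s w + (- alpha * (1 + alpha ^+ 2) * Y s.-1 w - alpha ^+ 2 * Y s.+2 w
                     - (1 - alpha ^+ 3) * mu) / (1 + alpha ^+ 2 + alpha ^+ 4)) /\
      ht2 @ \oo --> (Y s.+1 w + (- alpha ^+ 2 * Y s.-1 w - alpha * (1 + alpha ^+ 2) * Y s.+2 w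
                     - (1 - alpha ^+ 3) * mu) / (1 + alpha ^+ 2 + alpha ^+ 4))}.
Proof.
move=> a01 s0 _ _ mX0 meps mxi indep eid e2 e0 xib X02 mu Y.
have L1 := residual_law_of_large_numbers a01 mX0 meps mxi indep eid e2 xib X02.
have L2 := weighted_residual_law_of_large_numbers a01 mX0 meps mxi indep eid e2 xib X02.
have [p p0 L3] := inar_change_frequency a01 mX0 meps mxi indep eid e0 xib.
apply: (filterS _ (filterI L1 (filterI L2 L3))) => w [l1 [l2 l3]] {L1 L2 L3}.
pose x i : R := (inarX X0 eps xi i w)%:R.
pose y k := Y k w.
have yx k : k != s -> k != s.+1 -> y k = x k.
  by move=> /negbTE ks /negbTE ks1; rewrite /y /Y /inarY ks ks1 !addr0.
(* For a regular k neither k nor k - 1 is s or s + 1, so the regular sums see only the chain without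
   outliers. *)
have regE n (f : R -> R -> R) : regular_sum s n (fun k => f (y k) (y k.-1)) =
    regular_sum s n (fun k => f (x k) (x k.-1)).
  apply: eq_regular_sum => -[//|k] _ /=; rewrite !inE !negb_or !eqSS.
  by move=> /and3P[k1 k2 k3]; rewrite !yx.
have x_ge0 i : 0 <= x i by exact: ler0n.
have [M M0 meanM] := mean_bound a01 x_ge0 l1.
have change_le i : (inarX X0 eps xi i.+1 w != inarX X0 eps xi i w)%:R <=
    (x i.+1 - x i) ^+ 2.
  rewrite /x; move: (inarX _ _ _ i.+1 w) (inarX _ _ _ i w) => b a.
  have [->|ba] := eqVneq b a; first exact: sqr_ge0.
  have [ab|] := ltnP a b; first by rewrite -natrB ?(ltnW ab)// -natrX ler_nat expn_gt0 subn_gt0 ab.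
  rewrite leq_eqVlt (negbTE ba)/= => ltba.
  by rewrite -sqrrN opprB -natrB ?(ltnW ltba)// -natrX ler_nat expn_gt0 subn_gt0 ltba.
have [c c0 Hc] := design_lower_bound p0 M0 change_le l3 meanM.
(* Half of the constant [c] is given up to absorb the three omitted terms, each bounded by
   Cauchy-Schwarz independently of n. *)
have design_lb : \forall n \near \oo, forall u v,
    c / 2 * n%:R * (u ^+ 2 + v ^+ 2) <= design s y n u v.
  pose C := (x s.-1 ^+ 2 + 1) + (x s ^+ 2 + 1) + (x s.+1 ^+ 2 + 1).
  near=> n => u v.
  have Hn : forall u v, c * n%:R * (u ^+ 2 + v ^+ 2) <= \sum_(i < n) (u * x i + v) ^+ 2.
    by near: n.
  have nC : C <= c / 2 * n%:R.
    rewrite mulrC -ler_pdivrMr ?divr_gt0//; near: n.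
    exists (Num.bound `|C / (c / 2)|) => // k /= Nk.
    apply: le_trans (ler_norm _) _; apply: le_trans (ltW (archi_boundP _)) _ => //.
    by rewrite ler_nat.
  rewrite /design (regE n (fun _ b => (u * b + v) ^+ 2)) regular_sumE//=; last first.
    by near: n; exact: nbhs_infty_ge.
  have w0 : 0 <= u ^+ 2 + v ^+ 2 by rewrite addr_ge0 ?sqr_ge0.
  have h0 := Hn u v.
  have h1 := ler_wpM2r w0 nC.
  have h2 := sqr_affine_le (x s.-1) u v.
  have h3 := sqr_affine_le (x s) u v.
  have h4 := sqr_affine_le (x s.+1) u v.
  rewrite /C in h1; lra.
have score_cvg : score_sum s y n alpha mu / n%:R @[n --> \oo] --> (0 : R).
  rewrite (_ : (fun n => _) = fun n => regular_sum s n
      (fun k => (x k - alpha * x k.-1 - mu) * x k.-1) / n%:R).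
    apply: cvg_regular_mean => //; apply: cvg_trans l2.
    apply: near_eq_cvg; apply: nearW => n; congr (_ / _); apply: eq_bigr => i _ /=.
    by rewrite /inar_residual -/mu -!/(x _); ring.
  by apply/funext => n; rewrite -(regE n (fun a b => (a - alpha * b - mu) * b)).
have residual_cvg : residual_sum s y n alpha mu / n%:R @[n --> \oo] --> (0 : R).
  rewrite (_ : (fun n => _) = fun n => regular_sum s n
      (fun k => x k - alpha * x k.-1 - mu) / n%:R).
    apply: cvg_regular_mean => //; apply: cvg_trans l1.
    apply: near_eq_cvg; apply: nearW => n; congr (_ / _); apply: eq_bigr => i _ /=.
    by rewrite /inar_residual -/mu -!/(x _); ring.
  by apply/funext => n; rewrite -(regE n (fun a b => a - alpha * b - mu)).
have alpha1 : `|alpha| <= 1 by case/andP: a01 => ? ?; rewrite ger0_norm ltW.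
have [n0 [ha [hm [minH ha_cvg hm_cvg]]]] := profile_minimizer_cvg alpha1
  (divr_gt0 c0 (ltr0n R 2)) design_lb score_cvg residual_cvg.
exists n0, ha, hm, (fun n => theta1 s y (ha n) (hm n)),
  (fun n => theta2 s y (ha n) (hm n)).
have d0 := lt0r_neq0 (outlier_den_gt0 alpha).
rewrite /outlier_den in d0.
split; [exact: minH|split; [exact: ha_cvg|split; [exact: hm_cvg|split]]].
(* The stated limits are [theta1] and [theta2] at the true parameters, where -(1 + alpha^2 +
   alpha^4) + alpha^2 (1 + alpha + alpha^2) = -(1 - alpha^3) collects the [mu] terms of the
   first. *)
- rewrite (_ : _ + _ = theta1 s y alpha mu); first exact: cvg_theta1.
  by rewrite /theta1 /outlier_num /outlier_den /y; field.
- rewrite (_ : _ + _ = theta2 s y alpha mu); first exact: cvg_theta2.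
  by rewrite /theta2 /theta1 /outlier_num /outlier_den /y; field.
Unshelve. all: by end_near. Qed.
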